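(* Let $R$ be a commutative ring. Let $A\to X$ be a cofibration of digraphs, let $f\colon A\to A'$ be any digraph map, and let \[\begin{array}{ccc} A & \xrightarrow{f} & A'\\ \downarrow && \downarrow\\ X & \xrightarrow{g} & X'\end{array}\] be a pushout square in $\mathsf{DiGraph}$. Then for all $n\ge 0$ the induced map of relative homology modules $H_n(X,A;R)\to H_n(X',A';R)$ is an isomorphism.
   Context: Digraphs: a digraph $X$ is a set $X_V$ with a reflexive binary relation ($x\to y$ an edge); digraph maps are functions on vertices preserving the relation; $\mathsf{DiGraph}$ is the category (it has all colimits). An induced subgraph $A\subseteq X$: for $a,b\in A_V$, $a\to b$ in $A$ iff in $X$. A path of length $n$ from $x$ to $y$ is a sequence $x=v_0,\dots,v_n=y$ with $v_i\to v_{i+1}$. Cofibrations: for an induced subgraph $A\subseteq X$, $X^A$ is the induced subgraph on vertices admitting a path to a vertex of $A$. A projecting decomposition of $X$ w.r.t. $A$ is $\pi\colon X^A_V\to A_V$ such that for any $x\in X_V$ and $a\in A_V$ admitting a path from $x$, some path from $x$ to $a$ of minimal length passes through $\pi x$. A cofibration is an induced subgraph inclusion $A\to X$ with no edges from vertices of $A$ to vertices outside $A$, such that $X$ admits a projecting decomposition w.r.t. $A$. Path homology: $C_n(X;R)$ is the free $R$-module on tuples $(x_0,\dots,x_n)$ of vertices with $x_i\ne x_{i+1}$ (others are zero), with $\partial(x_0,\dots,x_n)=\sum_i(-1)^i(x_0,\dots,\widehat{x_i},\dots,x_n)$; $A_n(X;R)$ is spanned by such tuples with $x_i\to x_{i+1}$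 for all $i$; $\Omega_0=A_0$ and $\Omega_n=\{\omega\in A_n:\partial\omega\in A_{n-1}\}$. A digraph map induces a chain map on $\Omega_\bullet$ by applying it to vertices (degenerate tuples going to $0$). For an induced subgraph $A\subseteq X$, $\Omega_\bullet(A)$ is a subcomplex of $\Omega_\bullet(X)$, and the relative homology $H_n(X,A;R)$ is the $n$-th homology of the quotient complex $\Omega_\bullet(X)/\Omega_\bullet(A)$. The map in the claim is induced by the chain map $\Omega(g)$, which sends $\Omega(A)$ into $\Omega(A')$. *)

(* Defs.v *)
From HB Require Import structures.
From mathcomp Require Import all_boot all_order all_algebra.
From mathcomp Require Import finmap all_classical.
From mathcomp Require Import zify.

Set Implicit Arguments.
Unset Strict Implicit.
Unset Printing Implicit Defensive.

Import GRing.Theory.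
Local Open Scope classical_set_scope.
Local Open Scope ring_scope.
Local Open Scope quotient_scope.

Section Submodule.
Variables (R : pzRingType) (V : lmodType R).

Record submodule := Submodule {
  submod_set :> V -> Prop;
  submod0 : submod_set 0;
  submodD : forall u v, submod_set u -> submod_set v -> submod_set (u + v);
  submodZ : forall a u, submod_set u -> submod_set (a *: u)
}.

Variable W : submodule.

Definition submod_pred : {pred V} := fun v => `[< W v >].

Lemma submod_predP v : reflect (W v) (v \in submod_pred).
Proof. exact: asboolP. Qed.

Fact submod_pred_closed : subsemimod_closed submod_pred.
Proof.
split; first split.
- exact/submod_predP/submod0.
- by move=> u v /submod_predP hu /submod_predP hv; exact/submod_predP/submodD.
- by move=> a u /submod_predP hu; exact/submod_predP/submodZ.
Qed.

HB.instance Definition _ :=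
  GRing.isSubmodClosed.Build R V submod_pred submod_pred_closed.

Record submod_type := SubmodElt {
  submod_val : V;
  submod_valP : submod_val \in submod_pred
}.

HB.instance Definition _ := [isSub for submod_val].
HB.instance Definition _ := [Choice of submod_type by <:].
HB.instance Definition _ := [SubChoice_isSubLmodule of submod_type by <:].

Definition submod_in (v : V) (Wv : W v) : submod_type :=
  SubmodElt (introT (submod_predP v) Wv).

Lemma submod_typeP (w : submod_type) : W (val w).
Proof. exact/submod_predP/submod_valP. Qed.

Definition quot_mod := Quotient.quot submod_pred.

HB.instance Definition _ := GRing.Zmodule.on quot_mod.

Definition quot_pi (v : V) : quot_mod := \pi_(Quotient.quot submod_pred) v.

Definition quot_repr (q : quot_mod) : V :=
  repr (q : Quotient.quot submod_pred).

Lemma quot_reprK : cancel quot_repr quot_pi.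
Proof. exact: reprK. Qed.

Lemma quot_eqP u v : quot_pi u = quot_pi v <-> W (u - v).
Proof.
by split=> [/eqP|Wuv]; last apply/eqP; rewrite -Quotient.idealrBE;
   [move/submod_predP|exact/submod_predP].
Qed.

Lemma quot_piD u v : quot_pi (u + v) = quot_pi u + quot_pi v.
Proof. by rewrite /quot_pi !piE. Qed.

Definition quot_scale (a : R) (q : quot_mod) : quot_mod :=
  quot_pi (a *: quot_repr q).

Lemma quot_piZ a v : quot_pi (a *: v) = quot_scale a (quot_pi v).
Proof.
apply/quot_eqP; rewrite -scalerBr; apply: submodZ.
by apply/quot_eqP; rewrite quot_reprK.
Qed.

Fact quot_scalerA a b q :
  quot_scale a (quot_scale b q) = quot_scale (a * b) q.
Proof. by rewrite -[q]quot_reprK -!quot_piZ scalerA. Qed.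
Fact quot_scale1r : left_id 1 quot_scale.
Proof. by move=> q; rewrite -[q]quot_reprK -!quot_piZ scale1r. Qed.
Fact quot_scalerDr : right_distributive quot_scale +%R.
Proof.
move=> a p q; rewrite -[p]quot_reprK -[q]quot_reprK.
by rewrite -quot_piD -!quot_piZ -quot_piD scalerDr.
Qed.
Fact quot_scalerDl q : {morph quot_scale^~ q : a b / a + b}.
Proof.
by move=> a b; rewrite -[q]quot_reprK -!quot_piZ -quot_piD scalerDl.
Qed.

HB.instance Definition _ := GRing.Zmodule_isLmodule.Build R quot_mod
  quot_scalerA quot_scale1r quot_scalerDr quot_scalerDl.

Fact quot_pi_linear : linear quot_pi.
Proof. by move=> a u v; rewrite quot_piD quot_piZ. Qed.

HB.instance Definition _ :=
  GRing.isLinear.Build R V quot_mod *:%R quot_pi quot_pi_linear.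

End Submodule.

Section SubmoduleMaps.
Variables (R : pzRingType) (U V : lmodType R).
Variable (f : {linear U -> V}).

Definition lin_ker : submodule U.
Proof.
exists [set u | f u = 0] => /= [|u v hu hv|a u hu].
- exact: linear0.
- by rewrite linearD hu hv addr0.
- by rewrite linearZ_LR hu scaler0.
Defined.

Definition lin_image : submodule V.
Proof.
exists [set v | exists u, f u = v] => /= [|_ _ [u <-] [v <-]|a _ [u <-]].
- by exists 0; rewrite linear0.
- by exists (u + v); rewrite linearD.
- by exists (a *: u); rewrite linearZ_LR.
Defined.

Definition lin_preimage (W : submodule V) : submodule U.
Proof.
exists [set u | W (f u)] => /= [|u v hu hv|a u hu].
- by rewrite linear0; exact: submod0.
- by rewrite linearD; exact: submodD.
- by rewrite linearZ_LR; exact: submodZ.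
Defined.

Variables (S : submodule U) (T : submodule V).

Section Sub.
Hypothesis fST : forall u, S u -> T (f u).

Definition sub_map (s : submod_type S) : submod_type T :=
  submod_in (fST (submod_typeP s)).

Fact sub_map_linear : linear sub_map.
Proof. by move=> a u v; apply: val_inj; rewrite /= linearP. Qed.

HB.instance Definition _ := GRing.isLinear.Build R (submod_type S)
  (submod_type T) *:%R sub_map sub_map_linear.

End Sub.

(* [fST] is not used by the function, but its linearity depends on it *)
Definition quot_map (fST : forall u, S u -> T (f u)) (q : quot_mod S) :
    quot_mod T :=
  quot_pi T (f (quot_repr q)).

Lemma quot_mapE fST u : quot_map fST (quot_pi S u) = quot_pi T (f u).
Proof.
apply/quot_eqP; rewrite -linearB; apply: fST.
by apply/quot_eqP; rewrite quot_reprK.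
Qed.

Fact quot_map_linear fST : linear (quot_map fST).
Proof.
move=> a p q; rewrite -[p]quot_reprK -[q]quot_reprK.
by rewrite -linearP !quot_mapE -linearP /= linearP.
Qed.

HB.instance Definition _ fST := GRing.isLinear.Build R (quot_mod S)
  (quot_mod T) *:%R (quot_map fST) (quot_map_linear fST).

End SubmoduleMaps.
Arguments sub_map {R U V f S T} fST s.
Arguments quot_map {R U V f S T} fST q.

Definition span (R : pzRingType) (V : lmodType R) (S : set V) : submodule V.
Proof.
exists [set v | forall W : submodule V, (forall s, S s -> W s) -> W v] => /=.
- by move=> W _; exact: submod0.
- by move=> u v hu hv W SW; apply: submodD; [exact: hu|exact: hv].
- by move=> a u hu W SW; apply: submodZ; exact: hu.
Defined.

Section FreeModule.
Variables (R : pzRingType) (K : choiceType).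

Definition finsupp : submodule (K -> R^o).
Proof.
exists [set c | finite_set [set k | c k != 0]] => /= [|c d hc hd|a c hc].
- rewrite (_ : [set _ | _] = set0) //.
  by apply/seteqP; split => k //=; rewrite eqxx.
- apply: (@sub_finite_set _ _ ([set k | c k != 0] `|` [set k | d k != 0])).
    move=> k /=; have [ck0|] := eqVneq (c k) 0; last by left.
    by have -> : (c + d) k = d k; [rewrite -[RHS]add0r -ck0|right].
  by rewrite finite_setU.
- apply: sub_finite_set hc => k /=; apply: contra_neq => ck0.
  by rewrite -[RHS](scaler0 _ a) -ck0.
Defined.

Definition free_mod := submod_type finsupp.
HB.instance Definition _ := GRing.Lmodule.on free_mod.

Definition free_coef (c : free_mod) (k : K) : R := submod_val c k.
Arguments free_coef : simpl never.

Fact free_gen_subproof k : finsupp (fun j => (j == k)%:R).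
Proof.
apply: (@sub_finite_set _ _ [set k]) => [j /=|]; last exact: finite_set1.
by have [//|_] := eqVneq j k; rewrite eqxx.
Qed.

Definition free_gen (k : K) : free_mod := submod_in (free_gen_subproof k).

Variables (V : lmodType R) (b : K -> V).

Definition free_lift (c : free_mod) : V :=
  \sum_(k \in [set: K]) free_coef c k *: b k.

Lemma free_lift_fin (c : free_mod) (s : {fset K}) :
  (forall k, k \notin s -> free_coef c k = 0) ->
  free_lift c = \sum_(k <- s) free_coef c k *: b k.
Proof.
by move=> cs; rewrite /free_lift (fsbigTE s) // => k /cs ->; rewrite scale0r.
Qed.

Lemma free_suppP (c : free_mod) :
  exists s : {fset K}, forall k, k \notin s -> free_coef c k = 0.
Proof.
have /finite_fsetP[s sE] := submod_typeP c.
exists s => k ks; apply/eqP; apply: contraNT ks => ck.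
by have : [set k | free_coef c k != 0] k by []; rewrite sE.
Qed.

Fact free_lift_linear : linear free_lift.
Proof.
move=> a c d; have [s hs] := free_suppP c; have [t ht] := free_suppP d.
have Es k : k \notin (s `|` t)%fset -> free_coef c k = 0.
  by rewrite in_fsetU negb_or => /andP[/hs].
have Et k : k \notin (s `|` t)%fset -> free_coef d k = 0.
  by rewrite in_fsetU negb_or => /andP[_ /ht].
have E k : free_coef (a *: c + d) k = a * free_coef c k + free_coef d k by [].
rewrite (free_lift_fin Es) (free_lift_fin Et) (@free_lift_fin _ (s `|` t)%fset).
  rewrite scaler_sumr -big_split /=; apply: eq_bigr => k _.
  by rewrite E scalerDl scalerA.
by move=> k kst; rewrite E Es // Et // mulr0 addr0.
Qed.

HB.instance Definition _ :=
  GRing.isLinear.Build R free_mod V *:%R free_lift free_lift_linear.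

Lemma free_lift_gen k : free_lift (free_gen k) = b k.
Proof.
have E j : free_coef (free_gen k) j = (j == k)%:R by [].
rewrite (@free_lift_fin _ [fset k]%fset) ?big_seq_fset1 ?E ?eqxx ?scale1r //.
by move=> j; rewrite in_fset1 E => /negbTE->.
Qed.

End FreeModule.

Lemma free_genE (R : pzRingType) (K : choiceType) (c : free_mod R K) :
  free_lift (@free_gen R K) c = c.
Proof.
have [s hs] := free_suppP c; rewrite (free_lift_fin _ hs).
apply: val_inj; rewrite raddf_sum /=; apply/funext => j.
have -> : (\sum_(k <- s) val (free_coef c k *: free_gen R k)) j
   = \sum_(k <- s) free_coef c k * (j == k)%:R.
  by elim/big_rec2: _ => [//|k u v _ <-].
have [js|js] := boolP (j \in s); last first.
  rewrite big1_seq; first by rewrite -[RHS]/(free_coef c j) hs.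
  move=> k /= ks; case: eqP => [jk|]; last by rewrite mulr0.
  by rewrite jk ks in js.
rewrite (big_fsetD1 j) //= eqxx mulr1 big1_seq ?addr0 // => k /=.
by rewrite in_fsetD1 eq_sym => /andP[/negbTE-> _]; rewrite mulr0.
Qed.

Lemma free_ext (R : pzRingType) (K : choiceType) (V : lmodType R)
    (f g : {linear free_mod R K -> V}) :
  (forall k, f (free_gen R k) = g (free_gen R k)) -> f =1 g.
Proof.
move=> fg c; have [s hs] := free_suppP c.
rewrite -(free_genE c) (free_lift_fin _ hs) !linear_sum.
by apply: eq_bigr => k _; rewrite !linearZ_LR fg.
Qed.

Record complex (R : pzRingType) := Complex {
  cmod :> nat -> lmodType R;
  cdiff : forall n, {linear cmod n.+1 -> cmod n};
  cdiffK : forall n x, cdiff n (cdiff n.+1 x) = 0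
}.
Arguments cdiff {R} c n.

Record chain_map (R : pzRingType) (C D : complex R) := ChainMap {
  cmap :> forall n, {linear C n -> D n};
  cmap_diff : forall n x, cmap n (cdiff C n x) = cdiff D n (cmap n.+1 x)
}.

Record subcomplex (R : pzRingType) (C : complex R) := Subcomplex {
  subc_mod :> forall n, submodule (C n);
  subc_diff : forall n x, subc_mod n.+1 x -> subc_mod n (cdiff C n x)
}.

Section ImageSubcomplex.
Variables (R : pzRingType) (C D : complex R) (f : chain_map C D).

Fact image_subcomplex_subproof n x :
  lin_image (f n.+1) x -> lin_image (f n) (cdiff D n x).
Proof. by move=> [y <-]; exists (cdiff C n y); rewrite cmap_diff. Qed.

Definition image_subcomplex : subcomplex D :=
  @Subcomplex R D (fun n => lin_image (f n)) image_subcomplex_subproof.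

End ImageSubcomplex.

Section QuotientComplex.
Variables (R : pzRingType) (C : complex R) (B : subcomplex C).

Definition quot_diff n : {linear quot_mod (B n.+1) -> quot_mod (B n)} :=
  quot_map (@subc_diff R C B n).

Fact quot_diffK n q : quot_diff n (quot_diff n.+1 q) = 0.
Proof.
rewrite -[q]quot_reprK /quot_diff /=.
by rewrite !quot_mapE cdiffK linear0.
Qed.

Definition quot_complex : complex R :=
  @Complex R (fun n => quot_mod (B n)) quot_diff quot_diffK.

End QuotientComplex.

Section QuotientChainMap.
Variables (R : pzRingType) (C D : complex R) (f : chain_map C D).
Variables (B : subcomplex C) (E : subcomplex D).
Hypothesis fBE : forall n x, B n x -> E n (f n x).

Definition quot_cmap n : {linear quot_complex B n -> quot_complex E n} :=
  quot_map (@fBE n).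

Fact quot_cmap_diff n q :
  quot_cmap n (cdiff (quot_complex B) n q) =
  cdiff (quot_complex E) n (quot_cmap n.+1 q).
Proof.
rewrite -[q]quot_reprK /quot_cmap /= /quot_diff /=.
by rewrite !quot_mapE cmap_diff.
Qed.

Definition quot_chain_map : chain_map (quot_complex B) (quot_complex E) :=
  ChainMap quot_cmap_diff.

End QuotientChainMap.

Section Homology.
Variables (R : pzRingType) (C : complex R).

Definition full_submod (V : lmodType R) : submodule V :=
  @Submodule R V setT I (fun _ _ _ _ => I) (fun _ _ _ => I).

Definition cycles (n : nat) : submodule (C n) :=
  match n with
  | 0 => full_submod (C 0%N)
  | m.+1 => lin_ker (cdiff C m)
  end.

Definition boundaries (n : nat) : submodule (submod_type (cycles n)) :=
  lin_preimage (val : {linear submod_type (cycles n) -> C n})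
    (lin_image (cdiff C n)).

Definition homology (n : nat) : lmodType R := quot_mod (boundaries n).

End Homology.

Section HomologyMap.
Variables (R : pzRingType) (C D : complex R) (f : chain_map C D) (n : nat).

Fact cycles_map x : cycles C n x -> cycles D n (f n x).
Proof. by case: n x => //= m x dx; rewrite -cmap_diff dx linear0. Qed.

Fact boundaries_map z :
  boundaries C n z -> boundaries D n (sub_map cycles_map z).
Proof. by move=> [y dy]; exists (f n.+1 y); rewrite -cmap_diff dy. Qed.

Definition homology_map : {linear homology C n -> homology D n} :=
  quot_map boundaries_map.

End HomologyMap.

Record digraph := Digraph {
  vertex :> Type;
  edge : vertex -> vertex -> Prop;
  edge_refl : forall x, edge x x
}.

Record dimap (X Y : digraph) := DiMap {
  dimap_fun :> X -> Y;
  dimap_edge : forall x y, edge x y -> edge (dimap_fun x) (dimap_fun y)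
}.

Record is_pushout (A X A' X' : digraph) (i : dimap A X) (f : dimap A A')
    (g : dimap X X') (j : dimap A' X') : Prop := IsPushout {
  pushout_comm : forall a, g (i a) = j (f a);
  pushout_exists : forall (T : digraph) (u : dimap X T) (v : dimap A' T),
    (forall a, u (i a) = v (f a)) ->
    exists w : dimap X' T, (forall x, w (g x) = u x) /\ (forall a, w (j a) = v a);
  pushout_unique : forall (T : digraph) (w w' : dimap X' T),
    (forall x, w (g x) = w' (g x)) -> (forall a, w (j a) = w' (j a)) ->
    forall y, w y = w' y
}.

(* A tuple (x_0, ..., x_n) is a function on 'I_n.+1; for k : 'I_n, the
   consecutive entries x_k and x_(k+1) are [x (ordl k)] and [x (ordr k)]. *)
Definition ordl n (k : 'I_n) : 'I_n.+1 := widen_ord (leqnSn n) k.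
Definition ordr n (k : 'I_n) : 'I_n.+1 := lift ord0 k.

Section Paths.
Variable X : digraph.

Definition is_path n (p : 'I_n.+1 -> X) : Prop :=
  forall k : 'I_n, edge (p (ordl k)) (p (ordr k)).

Definition path_from_to (x y : X) n (p : 'I_n.+1 -> X) : Prop :=
  [/\ is_path p, p ord0 = x & p ord_max = y].

Definition has_path (x y : X) : Prop :=
  exists n (p : 'I_n.+1 -> X), path_from_to x y p.

Definition minimal_path (x y : X) n (p : 'I_n.+1 -> X) : Prop :=
  path_from_to x y p /\
  forall m (q : 'I_m.+1 -> X), path_from_to x y q -> (n <= m)%N.

End Paths.

Section Cofibrations.
Variables (A X : digraph) (i : dimap A X).

Definition induced_inclusion : Prop :=
  injective i /\ forall a b, edge (i a) (i b) -> edge a b.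

Definition reaching : Type := {x : X | exists a, has_path x (i a)}.

Definition projecting_decomposition (pi : reaching -> A) : Prop :=
  forall (x : reaching) (a : A), has_path (sval x) (i a) ->
  exists n (p : 'I_n.+1 -> X),
    minimal_path (sval x) (i a) p /\ exists k, p k = i (pi x).

Definition cofibration : Prop :=
  [/\ induced_inclusion,
      forall (a : A) (x : X), edge (i a) x -> exists b, x = i b
    & exists pi : reaching -> A, projecting_decomposition pi].

End Cofibrations.

Section PathChains.
Variables (R : pzRingType) (X : digraph).

Definition regular n (x : 'I_n.+1 -> X) : Prop :=
  forall k : 'I_n, x (ordl k) <> x (ordr k).

Definition reg_tuple n := {classic {x : 'I_n.+1 -> X | regular x}}.

Definition path_chain n : lmodType R := free_mod R (reg_tuple n).

(* The element (x_0, ..., x_n) of C_n(X; R), zero if the tuple is not regular *)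
Definition tuple_chain n (x : 'I_n.+1 -> X) : path_chain n :=
  match pselect (regular x) with
  | left rx => free_gen R (exist _ x rx : reg_tuple n)
  | right _ => 0
  end.

Lemma tuple_chain_reg n (x : 'I_n.+1 -> X) (rx : regular x) :
  tuple_chain x = free_gen R (exist _ x rx : reg_tuple n).
Proof.
rewrite /tuple_chain; case: pselect => // rx'.
by rewrite (Prop_irrelevance rx' rx).
Qed.

Lemma tuple_chain_irr n (x : 'I_n.+1 -> X) : ~ regular x -> tuple_chain x = 0.
Proof. by rewrite /tuple_chain; case: pselect. Qed.

Definition face n (i : 'I_n.+2) (x : 'I_n.+2 -> X) : 'I_n.+1 -> X :=
  fun k => x (lift i k).

Definition tuple_diff n (x : 'I_n.+2 -> X) : path_chain n :=
  \sum_(i < n.+2) (-1) ^+ i *: tuple_chain (face i x).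

Definition chain_diff n : {linear path_chain n.+1 -> path_chain n} :=
  free_lift (fun x : reg_tuple n.+1 => tuple_diff (sval x)).

Lemma tuple_diff_irr n (x : 'I_n.+2 -> X) : ~ regular x -> tuple_diff x = 0.
Proof.
move=> /existsNP[k /contrapT xk].
have klr : ordl k != ordr k by apply/eqP => /(congr1 val) /=; rewrite /bump; lia.
rewrite /tuple_diff (bigD1 (ordl k)) // (bigD1 (ordr k)) 1?eq_sym //=.
rewrite big1 ?addr0 => [|i /andP[il ir]].
  have -> : face (ordr k) x = face (ordl k) x.
    apply/funext => j; rewrite /face.
    have [jk|jk] := eqVneq (j : nat) (k : nat).
      have -> : lift (ordr k) j = ordl k.
        by apply: val_inj; rewrite /= /bump; lia.
      rewrite xk; congr x.
      by apply: val_inj; rewrite /= /bump; lia.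
    congr x; apply: val_inj; rewrite /= /bump; lia.
  rewrite -scalerDl /bump leq0n add1n exprS mulN1r addrN.
  by rewrite scale0r.
rewrite tuple_chain_irr ?scaler0 //.
have {}il : i <> k :> nat by move=> ik; case/eqP: il; exact: val_inj.
have {}ir : i <> k.+1 :> nat by move=> ik; case/eqP: ir; exact: val_inj.
have k'P : (k - (i < k) < n)%N by have := ltn_ord i; have := ltn_ord k; lia.
pose k' := Ordinal k'P => /(_ k'); apply; rewrite /face.
have -> : lift i (ordl k') = ordl k.
  by apply: val_inj; rewrite /= /bump; lia.
rewrite xk; congr x.
by apply: val_inj; rewrite /= /bump; lia.
Qed.

Lemma chain_diff_tuple n (x : 'I_n.+2 -> X) :
  chain_diff n (tuple_chain x) = tuple_diff x.
Proof.
have [rx|nrx] := pselect (regular x).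
  by rewrite (tuple_chain_reg rx) /chain_diff /= free_lift_gen.
by rewrite tuple_chain_irr // linear0 tuple_diff_irr.
Qed.

Lemma tuple_diffK n (x : 'I_n.+3 -> X) : chain_diff n (tuple_diff x) = 0.
Proof.
rewrite /tuple_diff linear_sum.
transitivity (\sum_(i < n.+3) \sum_(j < n.+2)
    (-1) ^+ i *: ((-1) ^+ j *: tuple_chain (face j (face i x)))).
  by apply: eq_bigr => i _; rewrite linearZ_LR chain_diff_tuple scaler_sumr.
rewrite pair_big /= (bigID (fun p : 'I_n.+3 * 'I_n.+2 => p.2 < p.1)%N) /=.
pose h (q : 'I_n.+3 * 'I_n.+2) : 'I_n.+3 * 'I_n.+2 := (ordr q.2, inord q.1).
pose h' (p : 'I_n.+3 * 'I_n.+2) : 'I_n.+3 * 'I_n.+2 := (ordl p.2, inord p.1.-1).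
rewrite (reindex_onto h h') /=; last first.
  move=> [i j] /= ji; congr pair; apply: val_inj => /=.
    by rewrite /bump inordK; have := ltn_ord i; lia.
  by rewrite inordK.
rewrite [X in X + _](eq_bigl (fun q : 'I_n.+3 * 'I_n.+2 => ~~ (q.2 < q.1)%N)).
  rewrite -big_split /= big1 // => -[i j] /=; rewrite -leqNgt => ij.
  have iE : (inord i : 'I_n.+2) = i :> nat.
    by rewrite inordK //; have := ltn_ord j; lia.
  have -> : face (inord i) (face (ordr j) x) = face j (face i x).
    apply/funext => k; rewrite /face; congr x.
    by apply: val_inj; rewrite /= iE /bump; lia.
  rewrite !scalerA -scalerDl /bump leq0n add1n iE exprS.
  by rewrite mulN1r mulNr -!exprD addnC addNr scale0r.
move=> [i j] /=; rewrite /h' /h /=; apply/idP/idP => [|ij].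
  rewrite xpair_eqE => /andP[+ /andP[/eqP /(congr1 val) /= + _]].
  by rewrite /bump; lia.
have iE : (inord i : 'I_n.+2) = i :> nat.
  by rewrite inordK //; have := ltn_ord j; lia.
rewrite iE xpair_eqE; apply/and3P; split.
- by rewrite /bump; lia.
- by apply/eqP/val_inj; rewrite /= iE.
- by apply/eqP/val_inj; rewrite /= inordK /bump; have := ltn_ord j; lia.
Qed.

Lemma chain_diffK n c : chain_diff n (chain_diff n.+1 c) = 0.
Proof.
apply: (@free_ext _ _ _ (chain_diff n \o chain_diff n.+1) \0) => -[x rx] /=.
by rewrite -(tuple_chain_reg rx) chain_diff_tuple tuple_diffK.
Qed.

Definition allowed n : submodule (path_chain n) :=
  span [set c | exists x : 'I_n.+1 -> X,
                  [/\ regular x, is_path x & c = tuple_chain x]].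

Definition omega (n : nat) : submodule (path_chain n) :=
  match n with
  | 0 => allowed 0
  | m.+1 =>
    @Submodule R (path_chain m.+1)
      [set w | allowed m.+1 w /\ allowed m (chain_diff m w)]
      (conj (submod0 _) (submod0 (lin_preimage (chain_diff m) (allowed m))))
      (fun u v hu hv => conj (submodD hu.1 hv.1)
         (@submodD _ _ (lin_preimage (chain_diff m) (allowed m)) _ _ hu.2 hv.2))
      (fun a u hu => conj (submodZ a hu.1)
         (@submodZ _ _ (lin_preimage (chain_diff m) (allowed m)) a _ hu.2))
  end.

Fact omega_diff_subproof n w : omega n.+1 w -> omega n (chain_diff n w).
Proof.
case: n w => [|n] w [Aw Adw]; first exact: Adw.
by split; [exact: Adw|rewrite chain_diffK; exact: (submod0 (allowed n))].
Qed.

Definition omega_diff n :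
    {linear submod_type (omega n.+1) -> submod_type (omega n)} :=
  sub_map (@omega_diff_subproof n).

Fact omega_diffK n w : omega_diff n (omega_diff n.+1 w) = 0.
Proof. by apply: val_inj; rewrite /= chain_diffK. Qed.

Definition omega_complex : complex R :=
  @Complex R (fun n => submod_type (omega n)) omega_diff omega_diffK.

End PathChains.

Section PathMap.
Variables (R : pzRingType) (X Y : digraph) (f : dimap X Y).

Definition path_map n : {linear path_chain R X n -> path_chain R Y n} :=
  free_lift (fun x : reg_tuple X n => tuple_chain R (f \o sval x)).

Lemma path_map_tuple n (x : 'I_n.+1 -> X) :
  path_map n (tuple_chain R x) = tuple_chain R (f \o x).
Proof.
have [rx|nrx] := pselect (regular x).
  by rewrite (tuple_chain_reg _ rx) /path_map /= free_lift_gen.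
rewrite !tuple_chain_irr ?linear0 // => rfx; apply: nrx => k xk.
by apply: (rfx k) => /=; rewrite xk.
Qed.

Lemma path_map_diff n c :
  path_map n (chain_diff R X n c) = chain_diff R Y n (path_map n.+1 c).
Proof.
apply: (@free_ext _ _ _ (path_map n \o chain_diff R X n)
                        (chain_diff R Y n \o path_map n.+1)) => -[x rx] /=.
rewrite -(tuple_chain_reg R rx) path_map_tuple !chain_diff_tuple.
rewrite /tuple_diff linear_sum; apply: eq_bigr => i _.
by rewrite linearZ_LR path_map_tuple.
Qed.

Lemma path_map_allowed n c : allowed R X n c -> allowed R Y n (path_map n c).
Proof.
move=> Ac; apply: (Ac (lin_preimage (path_map n) (allowed R Y n))).
move=> _ [x [rx px ->]] /= W genW; rewrite path_map_tuple.
have [rfx|nrfx] := pselect (regular (f \o x)); last first.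
  by rewrite tuple_chain_irr //; exact: submod0.
by apply: genW; exists (f \o x); split=> // k; apply: dimap_edge.
Qed.

Fact path_map_omega n w : omega R X n w -> omega R Y n (path_map n w).
Proof.
case: n w => [|n] w /=; first exact: path_map_allowed.
by move=> [Aw Adw]; split; rewrite -?path_map_diff; exact: path_map_allowed.
Qed.

Definition omega_cmap n : {linear omega_complex R X n -> omega_complex R Y n} :=
  sub_map (@path_map_omega n).

Fact omega_cmap_diff n w :
  omega_cmap n (cdiff (omega_complex R X) n w) =
  cdiff (omega_complex R Y) n (omega_cmap n.+1 w).
Proof. by apply: val_inj; rewrite /= path_map_diff. Qed.

Definition omega_map : chain_map (omega_complex R X) (omega_complex R Y) :=
  ChainMap omega_cmap_diff.

End PathMap.

(* The quotient of Omega(X) by the image of Omega(A) under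
   [i]; when [i] is an induced subgraph inclusion this image is Omega(A) itself
   viewed as a subcomplex of Omega(X). *)
Definition rel_complex (R : pzRingType) (A X : digraph) (i : dimap A X) :
    complex R :=
  quot_complex (image_subcomplex (omega_map R i)).

Definition rel_homology (R : pzRingType) (A X : digraph) (i : dimap A X)
    (n : nat) : lmodType R :=
  homology (rel_complex R i) n.

Section RelativeMap.
Variables (R : pzRingType) (A X A' X' : digraph).
Variables (i : dimap A X) (f : dimap A A') (g : dimap X X') (j : dimap A' X').
Hypothesis comm : forall a, g (i a) = j (f a).

Lemma path_map_comm n (c : path_chain R A n) :
  path_map R g n (path_map R i n c) = path_map R j n (path_map R f n c).
Proof.
apply: (@free_ext _ _ _ (path_map R g n \o path_map R i n)
                        (path_map R j n \o path_map R f n)) => -[x rx] /=.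
rewrite -(tuple_chain_reg R rx) !path_map_tuple; congr tuple_chain.
by apply/funext => k /=; exact: comm.
Qed.

Fact omega_map_image n w :
  image_subcomplex (omega_map R i) n w ->
  image_subcomplex (omega_map R j) n (omega_map R g n w).
Proof.
move=> [u <-]; exists (omega_map R f n u).
by apply: val_inj; rewrite /= path_map_comm.
Qed.

Definition rel_chain_map : chain_map (rel_complex R i) (rel_complex R j) :=
  quot_chain_map omega_map_image.

Definition rel_homology_map n :
    {linear rel_homology R i n -> rel_homology R j n} :=
  homology_map rel_chain_map n.

End RelativeMap.

(* Main.v *)
From HB Require Import structures.
From mathcomp Require Import all_boot all_order all_algebra.
From mathcomp Require Import all_classical.
From mathcomp Require Import zify.
Require Import Defs.

(** Each vertex [x] outside [A] has at most one edge into [A], namely to its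
projection [p x]. If [w] in Omega(X) is written in paths that start outside [A], the
allowedness of its boundary determines the coefficient of a path crossing into
[A] at step [k] from those of paths crossing later; hence modulo Omega(A) the
chain [w] is determined by the paths with at most their last vertex in [A].
These paths are the same for (X, A) and for (X', A'), so the map is injective
already on relative chains.

For surjectivity write a chain of Omega(X') as [P + M.a'] with [P] the part
outside [A'] and [M] the part followed by a single vertex [a'] of [A'], up to
the terms these two determine. With [h] the prism operator between the identity and
[p], the chain [P + (-1)^m h M] lies in Omega(X): on allowed chains [M] commutes
with the boundary, so the prism formula [d h = p - id - h d] leaves only allowed
terms. *)

Set Implicit Arguments.
Unset Strict Implicit.
Unset Printing Implicit Defensive.

Import GRing.Theory.
Local Open Scope ring_scope.

(** * Auxiliary facts on bijections, submodules and differences *)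

Lemma inj_surj_bijective (S T : Type) (F : S -> T) :
  injective F -> (forall y, exists x, F x = y) -> bijective F.
Proof.
by move=> Finj /choice[G FG]; exists G => // x; apply: Finj; rewrite FG.
Qed.

Lemma submod_sum (R : pzRingType) (V : lmodType R) (W : submodule V)
    (I : eqType) (s : seq I) (F : I -> V) :
  (forall k, k \in s -> W (F k)) -> W (\sum_(k <- s) F k).
Proof.
move=> WF; rewrite big_seq.
by elim/big_rec: _ => [|k v /WF Wk Wv]; [exact: submod0|exact: submodD].
Qed.

Lemma submodN (R : pzRingType) (V : lmodType R) (W : submodule V) v :
  W v -> W (- v).
Proof. by rewrite -scaleN1r; exact: submodZ. Qed.

Lemma submodB (R : pzRingType) (V : lmodType R) (W : submodule V) u v :
  W u -> W v -> W (u - v).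
Proof. by move=> Wu Wv; apply: submodD => //; exact: submodN. Qed.

Lemma subrBB (V : zmodType) (a b c : V) : (a - b) - (a - c) = c - b.
Proof. by rewrite opprB addrC addrA subrK. Qed.

Lemma subrACA (V : zmodType) (a b c d : V) :
  (a - b) - (c - d) = (a - c) - (b - d).
Proof. by rewrite !opprD addrACA. Qed.

(** * Coefficients of chains, and maps induced by vertex functions *)

Section Coefficients.
Variables (R : pzRingType) (X : digraph).

(** Total in [x], so that faces, which may be irregular, carry no regularity proof. *)
Definition tcoef n (x : 'I_n.+1 -> X) (c : path_chain R X n) : R^o :=
  match pselect (regular x) with
  | left rx => free_coef c (exist _ x rx : reg_tuple X n)
  | right _ => 0
  end.

Fact tcoef_linear n (x : 'I_n.+1 -> X) : linear (tcoef x).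
Proof.
move=> a c d; rewrite /tcoef; case: pselect => // _.
by rewrite scaler0 addr0.
Qed.

HB.instance Definition _ n (x : 'I_n.+1 -> X) :=
  GRing.isLinear.Build R (path_chain R X n) R^o *:%R (tcoef x)
    (tcoef_linear x).

Lemma tcoef_irr n (x : 'I_n.+1 -> X) c : ~ regular x -> tcoef x c = 0.
Proof. by rewrite /tcoef; case: pselect. Qed.

Lemma tcoef_tuple n (x y : 'I_n.+1 -> X) :
  regular y -> tcoef y (tuple_chain R x) = `[< x = y >]%:R.
Proof.
move=> ry; have [rx|nrx] := pselect (regular x); last first.
  rewrite tuple_chain_irr // linear0; case: asboolP => // xy.
  by rewrite xy in nrx.
rewrite (tuple_chain_reg R rx) /tcoef; case: pselect => // ry'.
rewrite /free_coef /=; case: asboolP => xy.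
  by rewrite (_ : exist _ y ry' = exist _ x rx) ?eqxx //; exact: eq_exist.
by case: eqP => // /(congr1 sval)/= /esym.
Qed.

Lemma tcoef_tuple_neq n (x y : 'I_n.+1 -> X) :
  x <> y -> tcoef y (tuple_chain R x) = 0.
Proof.
move=> xy; have [ry|/tcoef_irr//] := pselect (regular y).
by rewrite tcoef_tuple //; case: asboolP.
Qed.

(** A chain is a combination of its supporting tuples. The premise on the coefficient lets later
    proofs assume that the tuples of an allowed chain are paths. *)
Lemma chain_supp_ind n (V : lmodType R) (W : submodule V)
    (psi : {linear path_chain R X n -> V}) (c : path_chain R X n) :
  (forall x, regular x -> tcoef x c <> 0 -> W (psi (tuple_chain R x))) ->
  W (psi c).
Proof.
move=> H; have [s hs] := free_suppP c.
rewrite -(free_genE c) (free_lift_fin _ hs) linear_sum.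
apply: submod_sum => -[x rx] _; rewrite linearZ_LR.
have Ec : tcoef x c = free_coef c (exist _ x rx : reg_tuple X n).
  by rewrite /tcoef; case: pselect => // rx'; rewrite (Prop_irrelevance rx' rx).
rewrite -Ec; have [->|cx] := pselect (tcoef x c = 0).
  by rewrite scale0r; exact: submod0.
by rewrite -(tuple_chain_reg R rx); apply: submodZ; exact: H.
Qed.

Lemma eq_on_supp n (V : lmodType R) (psi1 psi2 : {linear path_chain R X n -> V})
    (c : path_chain R X n) :
  (forall x, regular x -> tcoef x c <> 0 ->
     psi1 (tuple_chain R x) = psi2 (tuple_chain R x)) ->
  psi1 c = psi2 c.
Proof.
move=> H; apply/eqP; rewrite -subr_eq0; apply/eqP.
(* [lin_ker idfun] is the zero submodule. *)
apply: (@chain_supp_ind n V (lin_ker idfun) (psi1 \- psi2)) => x rx cx /=.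
by rewrite H // subrr.
Qed.

Lemma tuple_ext n (V : lmodType R) (psi1 psi2 : {linear path_chain R X n -> V}) :
  (forall x, psi1 (tuple_chain R x) = psi2 (tuple_chain R x)) -> psi1 =1 psi2.
Proof. by move=> H c; apply: eq_on_supp => x _ _. Qed.

Lemma allowed_tuple n (x : 'I_n.+1 -> X) :
  is_path x -> allowed R X n (tuple_chain R x).
Proof.
move=> px; have [rx|nrx] := pselect (regular x).
  by move=> W; apply; exists x.
by rewrite tuple_chain_irr //; exact: submod0.
Qed.

Lemma allowedP n (c : path_chain R X n) :
  allowed R X n c <-> forall x, ~ is_path x -> tcoef x c = 0.
Proof.
split=> [Ac x npx|H].
  apply: (Ac (lin_ker (tcoef x))) => _ [y [ry py ->]] /=.
  by apply: tcoef_tuple_neq => yx; rewrite yx in py.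
apply: (@chain_supp_ind n _ (allowed R X n) idfun) => x rx cx /=.
by apply: allowed_tuple; apply: contrapT => /H.
Qed.

Lemma allowed_supp n (c : path_chain R X n) x :
  allowed R X n c -> tcoef x c <> 0 -> is_path x.
Proof. by move=> /allowedP H cx; apply: contrapT => /H. Qed.

Lemma omega_allowed n c : omega R X n c -> allowed R X n c.
Proof. by case: n c => [|n] c //= []. Qed.

End Coefficients.

(* The projection onto [A] need not preserve edges, so [path_map] does not apply
   to it. *)
HB.lock Definition push (R : pzRingType) (X Y : digraph) (p : X -> Y) n :
    {linear path_chain R X n -> path_chain R Y n} :=
  free_lift (fun x : reg_tuple X n => tuple_chain R (p \o sval x)).

Section FunctionPush.
Variables (R : pzRingType) (X Y : digraph) (p : X -> Y).
Notation push := (push R p).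

Lemma push_tuple n (x : 'I_n.+1 -> X) :
  push n (tuple_chain R x) = tuple_chain R (p \o x).
Proof.
have [rx|nrx] := pselect (regular x).
  by rewrite (tuple_chain_reg _ rx) push.unlock /= free_lift_gen.
rewrite !tuple_chain_irr ?linear0 // => rpx; apply: nrx => k xk.
by apply: (rpx k) => /=; rewrite xk.
Qed.

Lemma push_diff n c :
  push n (chain_diff R X n c) = chain_diff R Y n (push n.+1 c).
Proof.
apply: (@tuple_ext _ _ _ _ (push n \o chain_diff R X n)
                        (chain_diff R Y n \o push n.+1)) => x /=.
rewrite push_tuple !chain_diff_tuple /tuple_diff linear_sum.
by apply: eq_bigr => i _; rewrite linearZ_LR push_tuple.
Qed.

End FunctionPush.

(** * Cones and the prism operator of a vertex function *)

Definition tcons (X : digraph) n (v : X) (x : 'I_n.+1 -> X) : 'I_n.+2 -> X :=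
  fun k => if unlift ord0 k is Some l then x l else v.

HB.lock Definition cone (R : pzRingType) (X : digraph) (v : X) n :
    {linear path_chain R X n -> path_chain R X n.+1} :=
  free_lift (fun x : reg_tuple X n => tuple_chain R (tcons v (sval x))).

Section Cone.
Variables (R : pzRingType) (X : digraph).
Notation cone := (cone R).

Lemma tcons0 n v (x : 'I_n.+1 -> X) : tcons v x ord0 = v.
Proof. by rewrite /tcons unlift_none. Qed.

Lemma tconsS n v (x : 'I_n.+1 -> X) k : tcons v x (lift ord0 k) = x k.
Proof. by rewrite /tcons liftK. Qed.

Lemma tcons_ext n v (x : 'I_n.+1 -> X) (y : 'I_n.+2 -> X) :
  y ord0 = v -> (forall k, y (lift ord0 k) = x k) -> y = tcons v x.
Proof.
move=> y0 yS; apply/funext => k; have [l ->|->] := unliftP ord0 k.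
  by rewrite tconsS.
by rewrite tcons0.
Qed.

Lemma tcons_eta n (x : 'I_n.+2 -> X) : x = tcons (x ord0) (x \o lift ord0).
Proof. exact: tcons_ext. Qed.

Lemma ordl0 n : ordl (@ord0 n) = ord0.
Proof. exact: val_inj. Qed.

Lemma ordl_lift n (k : 'I_n) : ordl (lift ord0 k) = lift ord0 (ordl k).
Proof. exact: val_inj. Qed.

(** An arbitrary relation covers both paths ([edge]) and regularity (inequality). *)
Lemma forall_tcons (r : X -> X -> Prop) n v (x : 'I_n.+1 -> X) :
  (forall k, r (tcons v x (ordl k)) (tcons v x (ordr k))) <->
  r v (x ord0) /\ forall k, r (x (ordl k)) (x (ordr k)).
Proof.
split=> [H|[H0 HS] k].
  split=> [|k]; first by have := H ord0; rewrite ordl0 tcons0 tconsS.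
  by have := H (lift ord0 k); rewrite ordl_lift !tconsS.
have [l ->|->] := unliftP ord0 k; rewrite ?ordl_lift ?ordl0 !tconsS ?tcons0 //.
Qed.

Lemma is_path_tcons n v (x : 'I_n.+1 -> X) :
  is_path (tcons v x) <-> edge v (x ord0) /\ is_path x.
Proof. exact: forall_tcons. Qed.

Lemma regular_tcons n v (x : 'I_n.+1 -> X) :
  regular (tcons v x) <-> v <> x ord0 /\ regular x.
Proof. exact: (forall_tcons (fun a b => a <> b)). Qed.

Lemma face_tcons0 n v (x : 'I_n.+1 -> X) : face ord0 (tcons v x) = x.
Proof. by apply/funext => k; rewrite /face tconsS. Qed.

Lemma face_tconsS n v (x : 'I_n.+2 -> X) k :
  face (lift ord0 k) (tcons v x) = tcons v (face k x).
Proof.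
apply: tcons_ext => [|l]; rewrite /face.
  by rewrite (_ : lift _ _ = ord0) ?tcons0 //; exact: val_inj.
rewrite (_ : lift _ _ = lift ord0 (lift k l)) ?tconsS //.
by apply: val_inj; rewrite /= /bump; lia.
Qed.

Lemma cone_tuple v n (x : 'I_n.+1 -> X) :
  cone v n (tuple_chain R x) = tuple_chain R (tcons v x).
Proof.
have [rx|nrx] := pselect (regular x).
  by rewrite (tuple_chain_reg _ rx) cone.unlock /= free_lift_gen.
by rewrite !tuple_chain_irr ?linear0 // => /regular_tcons[].
Qed.

(** Face 0 removes the apex; every other face is the cone over a face of index one less, whence the
    sign. *)
Lemma diff_cone v n (c : path_chain R X n.+1) :
  chain_diff R X n.+1 (cone v n.+1 c) = c - cone v n (chain_diff R X n c).
Proof.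
apply: (@tuple_ext _ _ _ _ (chain_diff R X n.+1 \o cone v n.+1)
   (idfun \- (cone v n \o chain_diff R X n))) => x /=.
rewrite cone_tuple !chain_diff_tuple {1}/tuple_diff big_ord_recl.
rewrite expr0 scale1r face_tcons0; congr (_ + _).
rewrite /tuple_diff (linear_sum (cone v n)) -sumrN; apply: eq_bigr => k _.
rewrite face_tconsS linearZ_LR cone_tuple -scaleNr; congr (_ *: _).
by rewrite /= /bump add1n exprS mulN1r.
Qed.

(** In the lowest degree the last face leaves the apex itself instead of a cone over a boundary. *)
Lemma diff_cone0 v (x : 'I_1 -> X) :
  chain_diff R X 0 (tuple_chain R (tcons v x)) =
  tuple_chain R x - tuple_chain R (fun=> v).
Proof.
rewrite chain_diff_tuple /tuple_diff !big_ord_recl big_ord0 addr0.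
rewrite expr0 scale1r face_tcons0 expr1 scaleN1r; congr (_ - tuple_chain R _).
apply/funext => k; rewrite /face (_ : lift _ _ = ord0) ?tcons0 //.
by apply: val_inj; rewrite /= /bump; case: k => -[].
Qed.

End Cone.

Section PrismDef.
Variables (R : pzRingType) (X : digraph) (p : X -> X).

(* (x_0, ..., x_k, p x_k, ..., p x_m) *)
Definition prism_tuple m (k : 'I_m.+1) (x : 'I_m.+1 -> X) : 'I_m.+2 -> X :=
  fun l => if (l <= k)%N then x (inord l) else p (x (inord l.-1)).

Definition prism_chain m (x : 'I_m.+1 -> X) : path_chain R X m.+1 :=
  \sum_(k < m.+1) (-1) ^+ k *: tuple_chain R (prism_tuple k x).

End PrismDef.

HB.lock Definition prism (R : pzRingType) (X : digraph) (p : X -> X) m :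
    {linear path_chain R X m -> path_chain R X m.+1} :=
  free_lift (fun x : reg_tuple X m => prism_chain R p (sval x)).

Section Prism.
Variables (R : pzRingType) (X : digraph) (p : X -> X).
Notation prism_tuple := (prism_tuple p).
Notation prism_chain := (prism_chain R p).
Notation prism := (prism R p).

(** A repetition in [x] survives either among the entries up to [k] or, shifted by one, among the
    images under [p]. *)
Lemma prism_tuple_irr m k (x : 'I_m.+1 -> X) :
  ~ regular x -> ~ regular (prism_tuple k x).
Proof.
move=> /existsNP[l /contrapT xl] H; have lm := ltn_ord l.
have El : inord l = ordl l :> 'I_m.+1 by apply: val_inj; rewrite /= inordK; lia.
have Er : inord l.+1 = ordr l :> 'I_m.+1.
  by apply: val_inj; rewrite /= /bump inordK; lia.
have [lk|kl] := leqP l.+1 k.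
  apply: (H (ordl l)); rewrite /prism_tuple /= /bump add1n lk ltnW //.
  by rewrite El Er.
apply: (H (ordr l)); rewrite /prism_tuple /= /bump !add1n.
by rewrite leqNgt kl leqNgt (leqW kl) /= El Er xl.
Qed.

Lemma prism_tupleE m (x : 'I_m.+1 -> X) :
  prism m (tuple_chain R x) = prism_chain x.
Proof.
have [rx|nrx] := pselect (regular x).
  by rewrite (tuple_chain_reg _ rx) prism.unlock /= free_lift_gen.
rewrite tuple_chain_irr // linear0 /prism_chain big1 // => k _.
by rewrite tuple_chain_irr ?scaler0 //; exact: prism_tuple_irr.
Qed.

Lemma prism_tuple0 m (x : 'I_m.+1 -> X) :
  prism_tuple ord0 x = tcons (x ord0) (p \o x).
Proof.
apply: tcons_ext => [|k]; rewrite /prism_tuple /=.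
  by rewrite (_ : inord 0 = ord0) //; apply: val_inj; rewrite /= inordK.
by rewrite add0n inord_val.
Qed.

Lemma prism_tupleS m k v (x : 'I_m.+1 -> X) :
  prism_tuple (lift ord0 k) (tcons v x) = tcons v (prism_tuple k x).
Proof.
apply: tcons_ext => [|l]; rewrite /prism_tuple /=.
  by rewrite (_ : inord 0 = ord0) ?tcons0 //; apply: val_inj; rewrite /= inordK.
have /= lm := ltn_ord l; have /= km := ltn_ord k.
rewrite /bump !add1n ltnS; case: leqP => lk.
  rewrite (_ : inord l.+1 = lift ord0 (inord l)) ?tconsS //.
  by apply: val_inj; rewrite /= /bump !inordK //; lia.
rewrite (_ : inord (0 + l) = lift ord0 (inord l.-1)) ?tconsS //.
by apply: val_inj; rewrite /= /bump !inordK //; lia.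
Qed.

Lemma prism_chain1 (x : 'I_1 -> X) :
  prism_chain x = tuple_chain R (tcons (x ord0) (p \o x)).
Proof.
by rewrite /prism_chain big_ord_recl big_ord0 addr0 scale1r prism_tuple0.
Qed.

(** The term [k = 0] splits off and the others form a cone over the prism on the tail. This
    recursion avoids a double sum over faces in the prism formula. *)
Lemma prism_tcons m v (x : 'I_m.+1 -> X) :
  prism_chain (tcons v x) =
  tuple_chain R (tcons v (p \o tcons v x)) - cone R v m.+1 (prism_chain x).
Proof.
rewrite /prism_chain big_ord_recl scale1r prism_tuple0 tcons0; congr (_ + _).
rewrite (linear_sum (cone R v m.+1)) -sumrN; apply: eq_bigr => k _.
rewrite prism_tupleS linearZ_LR cone_tuple -scaleNr; congr (_ *: _).
by rewrite /= /bump add1n exprS mulN1r.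
Qed.

Lemma comp_tcons m v (x : 'I_m.+1 -> X) :
  p \o tcons v x = tcons (p v) (p \o x).
Proof. by apply: tcons_ext => [|k] /=; rewrite ?tcons0 ?tconsS. Qed.

Lemma prism_cone v m (c : path_chain R X m) :
  prism m.+1 (cone R v m c) =
  cone R v m.+1 (cone R (p v) m (push R p m c) - prism m c).
Proof.
apply: (@tuple_ext _ _ _ _ (prism m.+1 \o cone R v m)
  (cone R v m.+1 \o ((cone R (p v) m \o push R p m) \- prism m))) => x /=.
rewrite push_tuple !cone_tuple !prism_tupleE prism_tcons comp_tcons.
by rewrite linearB cone_tuple.
Qed.

Lemma diff_prism0 (c : path_chain R X 0) :
  chain_diff R X 0 (prism 0 c) = push R p 0 c - c.
Proof.
apply: (@tuple_ext _ _ _ _ (chain_diff R X 0 \o prism 0)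
  (push R p 0 \- idfun)) => x /=.
rewrite prism_tupleE prism_chain1 diff_cone0 push_tuple.
by congr (_ - tuple_chain R _); apply/funext => k; rewrite (ord1 k).
Qed.

(** The prism homotopy between the identity and [p]. Induction on the length: [prism_cone] writes
    the prism as a cone, and [diff_cone] reduces its boundary to the formula for the tail. *)
Lemma diff_prism m (c : path_chain R X m.+1) :
  chain_diff R X m.+1 (prism m.+1 c) =
  push R p m.+1 c - c - prism m (chain_diff R X m c).
Proof.
suff H x : chain_diff R X m.+1 (prism m.+1 (tuple_chain R x)) =
    push R p m.+1 (tuple_chain R x) - tuple_chain R x -
    prism m (chain_diff R X m (tuple_chain R x)).
  exact: (@tuple_ext _ _ _ _ (chain_diff R X _ \o prism _)
    ((push R p _ \- idfun) \- (prism _ \o chain_diff R X _)) H).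
elim: m {c} x => [|m IH] x; rewrite (tcons_eta x); move: (x ord0) (x \o _) => v y;
  rewrite -cone_tuple prism_cone diff_cone cone_tuple 2!push_tuple comp_tcons.
  rewrite cone_tuple (linearB (chain_diff R X 0)) /= diff_cone0 diff_prism0.
  rewrite push_tuple diff_cone0 (linearB (prism 0)) !prism_tupleE.
  rewrite !prism_chain1 subrBB (linearB (cone R v 0)) !cone_tuple.
  rewrite (_ : p \o (fun=> v) = fun=> p v) //.
  exact: subrACA.
rewrite (linearB (chain_diff R X m.+1)) diff_cone IH push_tuple subrACA subKr.
rewrite -(cone_tuple R v) diff_cone (linearB (prism m.+1)) prism_cone push_diff.
rewrite push_tuple (linearB (cone R v m.+1)) 2!cone_tuple; exact: subrACA.
Qed.

End Prism.

(** * Inclusions without outgoing edges, and chains modulo the subgraph *)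

Definition out_of (A X : digraph) (i : A -> X) (x : X) : Prop :=
  ~ exists a, x = i a.

(** The consequences of being a cofibration that determine chains modulo Omega(A). They are
    inherited by the pushout inclusion, so they serve for both [i] and [j]. *)
Definition sink_inclusion (A X : digraph) (i : dimap A X) : Prop :=
  [/\ induced_inclusion i,
      forall (a : A) (x : X), edge (i a) x -> exists b, x = i b
    & forall x a b, out_of i x -> edge x (i a) -> edge x (i b) -> a = b].

Lemma face_inj_at (X : digraph) n (x y : 'I_n.+2 -> X) k :
  face k x = face k y -> x k = y k -> x = y.
Proof.
move=> /funeqP fxy xy; apply/funext => l.
have [l' ->|-> //] := unliftP k l; exact: fxy.
Qed.

(** A partial inverse of [e]: tuples that do not lift into [N] go to zero. The chosen lift is unique
    when [e] is injective on [N]. *)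
Definition pull_tuple (R : pzRingType) (Y X : digraph) (N : Y -> Prop)
    (e : Y -> X) n (x : 'I_n.+1 -> X) : path_chain R Y n :=
  match pselect (exists y, (forall k, N (y k)) /\ e \o y = x) with
  | left Hy => tuple_chain R (projT1 (cid Hy))
  | right _ => 0
  end.

HB.lock Definition pull (R : pzRingType) (Y X : digraph) (N : Y -> Prop)
    (e : Y -> X) n : {linear path_chain R X n -> path_chain R Y n} :=
  free_lift (fun x : reg_tuple X n => pull_tuple R N e (sval x)).

Section PullTheory.
Variables (R : pzRingType) (Y X : digraph) (N : Y -> Prop) (e : Y -> X).
Notation pull := (pull R N e).

Lemma pull_out n (x : 'I_n.+1 -> X) :
  (exists k, forall y, N y -> e y <> x k) -> pull n (tuple_chain R x) = 0.
Proof.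
move=> [k xk]; have [rx|nrx] := pselect (regular x); last first.
  by rewrite tuple_chain_irr // linear0.
rewrite (tuple_chain_reg _ rx) pull.unlock /= free_lift_gen /pull_tuple.
case: pselect => //= -[y [Ny ey]]; case: (xk (y k) (Ny k)).
by rewrite -ey.
Qed.

Hypothesis e_inj : forall y z, N y -> N z -> e y = e z -> y = z.

Lemma pull_in n (y : 'I_n.+1 -> Y) :
  (forall k, N (y k)) -> pull n (tuple_chain R (e \o y)) = tuple_chain R y.
Proof.
move=> Ny; have [ry|nry] := pselect (regular y); last first.
  rewrite !tuple_chain_irr ?linear0 // => rey; apply: nry => k yk.
  by apply: (rey k) => /=; rewrite yk.
have rey : regular (e \o y) by move=> k /e_inj; move=> /(_ (Ny _) (Ny _))/ry.
rewrite (tuple_chain_reg _ rey) pull.unlock /= free_lift_gen /pull_tuple.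
case: pselect => [Hz|[]]; last by exists y.
case: cid => z /= [Nz /funeqP ez]; congr tuple_chain; apply/funext => k.
exact: e_inj (ez k).
Qed.

End PullTheory.

Section SinkInclusion.
Variables (R : comPzRingType) (A X : digraph) (i : dimap A X).
Hypothesis sink_i : sink_inclusion i.

Lemma out_edge x y : edge x y -> out_of i y -> out_of i x.
Proof.
case: sink_i => _ noout _ xy ny [a xE]; apply: ny.
by move: xy; rewrite xE => /noout.
Qed.

Lemma out_path n (x : 'I_n.+1 -> X) (k l : 'I_n.+1) :
  is_path x -> (k <= l)%N -> out_of i (x l) -> out_of i (x k).
Proof.
move=> px; move El : (nat_of_ord l) => m.
elim: m l El => [|m IH] l El kl nl.
  by rewrite (_ : k = l) //; apply: val_inj => /=; lia.
have [->//|kl'] := eqVneq k l.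
have mn : (m < n)%N by have := ltn_ord l; lia.
have klm : (k <= m)%N.
  by move: kl'; rewrite -(inj_eq val_inj) /=; lia.
apply: (IH (ordl (Ordinal mn))) => //.
apply: out_edge (px _) _; rewrite (_ : ordr _ = l) //.
by apply: val_inj; rewrite /= /bump; lia.
Qed.

(* Deleting the first vertex [x_(k+1)] of [x] in [A] creates a non-edge, and the
   only other paths producing the same face have their (k+1)-st vertex outside
   [A]; so the coefficients are determined by those at later crossings. *)
Lemma omega_determined n (w : path_chain R X n) :
  omega R X n w ->
  (forall x, regular x -> is_path x ->
     (forall k : 'I_n.+1, k = n.-1 :> nat -> out_of i (x k)) ->
     tcoef x w = 0) ->
  forall x, out_of i (x ord0) -> tcoef x w = 0.
Proof.
case: sink_i => -[i_inj i_ind] noout one_edge Ow H.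
have aw := omega_allowed Ow.
(* Downward induction on the position [k]; [d] is its distance to [n.-1], where the assumption on
   [w] applies. *)
suff K d (k : 'I_n.+1) x : (k + d = n.-1)%N -> out_of i (x k) -> tcoef x w = 0.
  by move=> x; apply: (K n.-1).
elim: d k x => [|d IH] k x kd nk;
  (have [rx|/tcoef_irr//] := pselect (regular x));
  (have [px|npx] := pselect (is_path x); last by move/allowedP: aw; exact).
  apply: H => // l ln; rewrite (_ : l = k) //; apply: val_inj => /=; lia.
case: n => [|[|n]] in w Ow H aw IH k x kd nk rx px *; try by move: kd => /=; lia.
have kn : (k.+1 < n.+2)%N by move: kd => /=; lia.
pose k0 : 'I_n.+2 := Ordinal (ltnW kn); pose k1 : 'I_n.+2 := Ordinal kn.
have Ek0 : ordl k0 = k by apply: val_inj.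
have Ek1 : ordr k0 = ordl k1 by apply: val_inj.
have e01 := px k0; have e12 := px k1; rewrite Ek0 Ek1 in e01.
(* If the next vertex is still outside [A], induct. Otherwise [x] crosses at this step, and the
   vertex after it lies in [A] too. *)
have [n1|/contrapT[b xb]] := pselect (out_of i (x (ordl k1))).
  by apply: (IH (ordl k1)) => //=; move: kd => /=; lia.
have [c xc] : exists c, x (ordr k1) = i c by apply: (noout b); rewrite -xb.
have bc : b <> c by move=> bc; apply: (rx k1); rewrite xb xc bc.
have l0 : lift (ordl k1) (ordl (Ordinal (kn : k < n.+1)%N)) = k.
  by apply: val_inj; rewrite /= /bump; lia.
have l1 : lift (ordl k1) (ordr (Ordinal (kn : k < n.+1)%N)) = ordr k1.
  by apply: val_inj; rewrite /= /bump; lia.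
have ry : regular (face (ordl k1) x).
  move=> l; rewrite /face; have [lk|lk] := eqVneq l (Ordinal (kn : k < n.+1)%N).
    by rewrite lk l0 l1 => xk; apply: nk; exists c; rewrite xk.
  have lk' : l <> k :> nat by move=> E; case/eqP: lk; apply: val_inj.
  have l'P : (bump k.+1 l < n.+2)%N by have := ltn_ord l; rewrite /bump; lia.
  have := rx (Ordinal l'P); congr (x _ <> x _);
    apply: val_inj; rewrite /= /bump; lia.
have nxk : ~ edge (x k) (x (ordr k1)).
  move=> xkc; apply: bc; apply: (one_edge (x k)) => //; first by rewrite -xb.
  by rewrite -xc.
have npy : ~ is_path (face (ordl k1) x).
  by move=> /(_ (Ordinal (kn : k < n.+1)%N)); rewrite /face l0 l1.
have /allowedP/(_ _ npy) : allowed R X n.+1 (chain_diff R X n.+1 w) by case: Ow.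
(* Among the tuples of [w], only [x] contributes to this face. *)
suff -> : tcoef (face (ordl k1) x) (chain_diff R X n.+1 w) =
    (-1) ^+ k1 *: tcoef x w.
  move=> /(congr1 (GRing.scale ((-1) ^+ k1))).
  by rewrite scaler0 scalerA -expr2 sqrr_sign scale1r.
apply: (@eq_on_supp R X n.+2 R^o (tcoef _ \o chain_diff R X n.+1)
  ((-1) ^+ k1 \*: tcoef x)) => z rz wz /=.
have pz := allowed_supp aw wz.
rewrite chain_diff_tuple /tuple_diff linear_sum (bigD1 (ordl k1)) //=.
rewrite linearZ_LR /= !tcoef_tuple // big1 ?addr0.
  rewrite (@asbool_equiv_eq (face _ z = _) (z = x)) //; split=> [fzx|->//].
  apply: (face_inj_at fzx); rewrite xb.
  have zk : z k = x k.
    move/funeqP: fzx => /(_ (ordl (Ordinal (kn : k < n.+1)%N))).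
    by rewrite /face l0.
  (* If [z] crosses later, its coefficient is zero by induction; if it crosses here, its vertex in
     [A] is the unique target of an edge from [x k]. *)
  have [n1|/contrapT[b' zb]] := pselect (out_of i (z (ordl k1))).
    by case: wz; apply: (IH (ordl k1)) => //=; move: kd => /=; lia.
  rewrite zb; congr (i _); apply: (one_edge (x k)) => //; last by rewrite -xb.
  by rewrite -zb -zk -Ek0 -Ek1.
(* Deleting any other vertex leaves the two ends of the non-edge consecutive in the path [z]. *)
move=> l lk1; rewrite linearZ_LR /= tcoef_tuple_neq ?scaler0 // => fzx.
have lk : l <> k.+1 :> nat by move=> E; case/eqP: lk1; apply: val_inj.
move/funeqP: fzx => fzx; case: nxk.
have f0 := fzx (ordl (Ordinal (kn : k < n.+1)%N)).
have f1 := fzx (ordr (Ordinal (kn : k < n.+1)%N)).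
rewrite /face l0 in f0; rewrite /face l1 in f1; rewrite -f0 -f1.
have k'P : (bump l k < n.+2)%N by rewrite /bump; lia.
have := pz (Ordinal k'P); congr (edge (z _) (z _));
  apply: val_inj; rewrite /= /bump; lia.
Qed.

End SinkInclusion.

Lemma tcoef_path_map_inj (R : pzRingType) (A X : digraph) (i : dimap A X) n
    (y : 'I_n.+1 -> A) (c : path_chain R A n) :
  injective i -> tcoef (i \o y) (path_map R i n c) = tcoef y c.
Proof.
move=> i_inj.
have eq_comp z : (i \o z = i \o y) <-> (z = y).
  split=> [/funeqP E|->//]; apply/funext => k; exact: i_inj (E k).
apply: (@tuple_ext _ _ _ _ (tcoef (i \o y) \o path_map R i n) (tcoef y)) => z /=.
rewrite path_map_tuple; have [ry|nry] := pselect (regular y).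
  rewrite !tcoef_tuple ?(asbool_equiv_eq (eq_comp z)) //.
  by move=> k /i_inj/ry.
rewrite !tcoef_irr // => riy; apply: nry => k yk.
by apply: (riy k); rewrite /= yk.
Qed.

Section SinkImage.
Variables (R : comPzRingType) (A X : digraph) (i : dimap A X).
Hypothesis sink_i : sink_inclusion i.

(** A path starting in [A] stays in [A] and is a path there, the subgraph being induced. As [i] also
    reflects paths, the boundary of the lift is allowed. *)
Lemma omega_image n (w : path_chain R X n) :
  omega R X n w ->
  (forall x, out_of i (x ord0) -> tcoef x w = 0) ->
  exists u, omega R A n u /\ path_map R i n u = w.
Proof.
case: (sink_i) => -[i_inj i_ind] noout _ Ow H.
have aw := omega_allowed Ow.
have lift_supp x : tcoef x w <> 0 -> exists2 y, is_path y & i \o y = x.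
  move=> wx; have px := allowed_supp aw wx.
  have inA k : exists a, x k = i a.
    apply: contrapT => nk; apply: wx; apply: H.
    exact: (@out_path _ _ _ sink_i _ _ ord0 k px).
  have [y yE] := choice inA; exists y; last by apply/funext => k /=; rewrite yE.
  by move=> k; apply: i_ind; rewrite -!yE.
pose u := pull R (fun=> True) i n w.
have pullE y : pull R (fun=> True) i n (tuple_chain R (i \o y)) = tuple_chain R y.
  by apply: pull_in => // a b _ _ /i_inj.
have uE : path_map R i n u = w.
  apply: (@eq_on_supp _ _ _ _ (path_map R i n \o pull R (fun=> True) i n) idfun).
  by move=> _ _ /lift_supp[y _ <-] /=; rewrite pullE path_map_tuple.
exists u; split=> //.
have au : allowed R A n u.
  apply: chain_supp_ind => _ _ /lift_supp[y py <-].
  by rewrite pullE; exact: allowed_tuple.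
case: n => [//|m] in w Ow H aw lift_supp u pullE uE au *; split=> //.
apply/allowedP => y npy; rewrite -(tcoef_path_map_inj _ _ i_inj).
rewrite path_map_diff uE; case: Ow => _ /allowedP; apply => piy.
by apply: npy => k; apply: i_ind; exact: piy.
Qed.

(** The vanishing criterion for relative chains, used over [i] for injectivity and over [j] for
    surjectivity. *)
Lemma omega_rel0 n (w : path_chain R X n) :
  omega R X n w ->
  (forall x, regular x -> is_path x ->
     (forall k : 'I_n.+1, k = n.-1 :> nat -> out_of i (x k)) ->
     tcoef x w = 0) ->
  exists u, omega R A n u /\ path_map R i n u = w.
Proof. by move=> Ow H; apply: omega_image; [|exact: omega_determined]. Qed.

End SinkImage.

(** * Chains cut off just before entering A, and their prisms *)

Section EndingChains.
Variables (R : pzRingType) (A X : digraph) (i : dimap A X) (p : X -> X).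
Hypothesis p_edge : forall x a, out_of i x -> edge x (i a) -> p x = i a.
(** What a projecting decomposition says about a path of length two into [A]. *)
Hypothesis p_step : forall x y a, out_of i x -> out_of i y -> edge x y ->
  edge y (i a) -> p x = p y \/ exists2 b, edge x (i b) & edge (i b) (p y).

(** What remains of a path whose only vertex in [A] is the last, once that vertex is removed. *)
Definition ending_tuple n (x : 'I_n.+1 -> X) : Prop :=
  [/\ is_path x, forall k, out_of i (x k) & exists a, edge (x ord_max) (i a)].

Definition ending n : submodule (path_chain R X n) :=
  span [set c | exists2 x : 'I_n.+1 -> X, ending_tuple x & c = tuple_chain R x].

(** Recording the first vertex makes allowedness pass to cones whose apex has an edge to it. *)
Definition paths_from n (v : X) : submodule (path_chain R X n) :=
  span [set c | exists x : 'I_n.+1 -> X,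
          [/\ is_path x, x ord0 = v & c = tuple_chain R x]].

Lemma paths_from_allowed n v c : paths_from n v c -> allowed R X n c.
Proof. by apply => _ [x [px _ ->]]; exact: allowed_tuple. Qed.

Lemma paths_from_tuple n (x : 'I_n.+1 -> X) :
  is_path x \/ ~ regular x -> paths_from n (x ord0) (tuple_chain R x).
Proof.
move=> [px W genW|nrx]; first by apply: genW; exists x.
by rewrite tuple_chain_irr //; exact: submod0.
Qed.

Lemma paths_from_cone n u v c :
  edge u v -> paths_from n v c -> paths_from n.+1 u (cone R u n c).
Proof.
move=> uv Pc; apply: (Pc (lin_preimage (cone R u n) (paths_from n.+1 u))).
move=> _ [x [px xv ->]] /= W genW.
rewrite cone_tuple; apply: genW; exists (tcons u x); split=> //.
  by apply/is_path_tcons; rewrite xv.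
exact: tcons0.
Qed.

(** By [p_step], each step of [x] is either collapsed by [p], which makes the image irregular, or
    sent to an edge. In the second case the first vertex again has an edge into [A], which is what
    the induction hands on to the preceding step. *)
Lemma ending_comp n (x : 'I_n.+1 -> X) : ending_tuple x ->
  ~ regular (p \o x) \/ (exists a, edge (x ord0) (i a)) /\ is_path (p \o x).
Proof.
elim: n x => [|n IH] x.
  move=> [_ nx [a xa]]; right; split; last by case.
  have E : ord_max = ord0 :> 'I_1 by apply: val_inj.
  by exists a; rewrite -E.
rewrite (tcons_eta x); move: (x ord0) (x \o _) => v y [] /is_path_tcons[vy py] nx.
have -> : ord_max = lift ord0 ord_max :> 'I_n.+2 by apply: val_inj.
rewrite tconsS => ya; rewrite comp_tcons tcons0.
have nv : out_of i v by have := nx ord0; rewrite tcons0.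
have ny k : out_of i (y k) by have := nx (lift ord0 k); rewrite tconsS.
case: (IH y) => [|nry|[[a y0a] ppy]]; first by split.
  by left=> /regular_tcons[].
have [pE|[b vb bp]] := p_step nv (ny ord0) vy y0a.
  by left=> /regular_tcons[]; rewrite pE.
right; split; first by exists b.
by apply/is_path_tcons; rewrite (p_edge nv vb).
Qed.

(** By [prism_tcons] only the term (x_0, p x_0, ..., p x_n) is to be checked; by [ending_comp] it is
    irregular, or a path beginning with the edge from x_0 into [A]. *)
Lemma prism_ending_tuple n (x : 'I_n.+1 -> X) : ending_tuple x ->
  paths_from n.+1 (x ord0) (prism_chain R p x).
Proof.
have cons_p m (y : 'I_m.+1 -> X) : ending_tuple y ->
    paths_from m.+1 (y ord0) (tuple_chain R (tcons (y ord0) (p \o y))).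
  move=> ey; rewrite -{1}(tcons0 (y ord0) (p \o y)).
  apply: paths_from_tuple; have [nr|[[a ya] pp]] := ending_comp ey.
    by right=> /regular_tcons[].
  left; apply/is_path_tcons; split=> //=.
  by case: ey => _ ny _; rewrite (p_edge (ny _) ya).
elim: n x => [|n IH] x ex; first by rewrite prism_chain1; exact: cons_p.
move: ex (cons_p _ _ ex).
rewrite (tcons_eta x); move: (x ord0) (x \o _) => v y.
move=> [] /is_path_tcons[vy py] nx.
have -> : ord_max = lift ord0 ord_max :> 'I_n.+2 by apply: val_inj.
rewrite tconsS tcons0 => ya Pv; rewrite prism_tcons.
apply: submodB => //; apply: paths_from_cone vy _; apply: IH; split=> // k.
by have := nx (lift ord0 k); rewrite tconsS.
Qed.

Lemma prism_ending n c : ending n c -> allowed R X n.+1 (prism R p n c).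
Proof.
move=> Ec; apply: (Ec (lin_preimage (prism R p n) (allowed R X n.+1))).
move=> _ [x ex ->] /=; rewrite prism_tupleE.
exact: paths_from_allowed (prism_ending_tuple ex).
Qed.

Lemma push_ending n c : ending n c -> allowed R X n (push R p n c).
Proof.
move=> Ec; apply: (Ec (lin_preimage (push R p n) (allowed R X n))).
move=> _ [x ex ->] /=; rewrite push_tuple.
have [nr|[_ pp]] := ending_comp ex; last exact: allowed_tuple.
by rewrite tuple_chain_irr //; exact: (submod0 (allowed R X n)).
Qed.

End EndingChains.

(* (x_0, ..., x_n, a') |-> (x_0, ..., x_n) for x_0, ..., x_n outside A and a' in
   A'; zero on tuples of any other shape. *)
HB.lock Definition cut (R : pzRingType) (A X A' X' : digraph) (i : dimap A X)
    (g : dimap X X') (j : dimap A' X') n :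
    {linear path_chain R X' n.+1 -> path_chain R X n} :=
  free_lift (fun y : reg_tuple X' n.+1 =>
    if `[< out_of j (sval y ord_max) >] then 0
    else pull R (out_of i) g n (tuple_chain R (sval y \o @ordl n.+1))).

(** * Lifting and reflecting chains along the pushout square *)

Section Faces.
Variables (X : digraph) (n : nat).

Lemma face_max (y : 'I_n.+2 -> X) : face ord_max y = y \o @ordl n.+1.
Proof.
apply/funext => k; congr y; apply: val_inj; rewrite /= /bump.
by have := ltn_ord k; lia.
Qed.

Lemma face_ordl_max (y : 'I_n.+2 -> X) k : face (ordl k) y ord_max = y ord_max.
Proof.
rewrite /face; congr y; apply: val_inj; rewrite /= /bump.
by have := ltn_ord k; lia.
Qed.

Lemma face_ordl (y : 'I_n.+3 -> X) k :
  face (ordl k) y \o @ordl n.+1 = face k (y \o @ordl n.+2).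
Proof. by apply/funext => l; congr y; apply: val_inj. Qed.

End Faces.

Lemma ord_ordlP n (k : 'I_n.+1) : (exists l, k = ordl l) \/ k = ord_max.
Proof.
have [kn|kn] := ltnP k n; first by left; exists (Ordinal kn); apply: val_inj.
by right; apply: val_inj => /=; have := ltn_ord k; lia.
Qed.

Section Excision.
Variables (R : comPzRingType) (A X A' X' : digraph).
Variables (i : dimap A X) (f : dimap A A') (g : dimap X X') (j : dimap A' X').
Variable p : X -> X.
Hypothesis comm : forall a, g (i a) = j (f a).
Hypothesis sink_i : sink_inclusion i.
Hypothesis sink_j : sink_inclusion j.
Hypothesis p_edge : forall x a, out_of i x -> edge x (i a) -> p x = i a.
Hypothesis p_step : forall x y a, out_of i x -> out_of i y -> edge x y ->
  edge y (i a) -> p x = p y \/ exists2 b, edge x (i b) & edge (i b) (p y).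
(** The premise [A] accounts for an empty [A], where no such [b] exists. *)
Hypothesis p_in : A -> forall x, exists b, p x = i b.
Hypothesis g_out : forall x, out_of i x -> out_of j (g x).
Hypothesis g_inj : forall x y,
  out_of i x -> out_of i y -> g x = g y -> x = y.
Hypothesis g_surj : forall y, out_of j y -> exists2 x, out_of i x & g x = y.
Hypothesis g_edge : forall x y,
  out_of i x -> out_of i y -> edge (g x) (g y) -> edge x y.
Hypothesis g_edge_in : forall x a',
  out_of i x -> edge (g x) (j a') -> exists2 a, edge x (i a) & f a = a'.

Notation pull := (pull R (out_of i) g).
Notation cut := (cut R i g j).

Lemma lift_out n (y : 'I_n.+1 -> X') : (forall k, out_of j (y k)) ->
  exists2 x, forall k, out_of i (x k) & g \o x = y.
Proof.
move=> ny; have /choice[x xP] k : exists x, out_of i x /\ g x = y k.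
  by have [x nx xE] := g_surj (ny k); exists x.
exists x => [k|]; first by case: (xP k).
by apply/funext => k; case: (xP k).
Qed.

Lemma pull_lift n (x : 'I_n.+1 -> X) : (forall k, out_of i (x k)) ->
  pull n (tuple_chain R (g \o x)) = tuple_chain R x.
Proof. exact/pull_in/g_inj. Qed.

Lemma pull_cross n (y : 'I_n.+1 -> X') k :
  ~ out_of j (y k) -> pull n (tuple_chain R y) = 0.
Proof.
by move=> nk; apply: pull_out; exists k => x /g_out nx gx; apply: nk; rewrite -gx.
Qed.

Lemma cut_reg n (y : 'I_n.+2 -> X') : regular y ->
  cut n (tuple_chain R y) =
  if `[< out_of j (y ord_max) >] then 0
  else pull n (tuple_chain R (y \o @ordl n.+1)).
Proof.
by move=> ry; rewrite (tuple_chain_reg R ry) cut.unlock /= free_lift_gen.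
Qed.

Lemma cut_out n (y : 'I_n.+2 -> X') :
  out_of j (y ord_max) -> cut n (tuple_chain R y) = 0.
Proof.
move=> ny; have [ry|nry] := pselect (regular y); last first.
  by rewrite tuple_chain_irr // linear0.
by rewrite cut_reg //; case: asboolP.
Qed.

Lemma cut_cross n (y : 'I_n.+2 -> X') k :
  ~ out_of j (y (ordl k)) -> cut n (tuple_chain R y) = 0.
Proof.
move=> ny; have [ry|nry] := pselect (regular y); last first.
  by rewrite tuple_chain_irr // linear0.
rewrite cut_reg //; case: asboolP => // _; exact: pull_cross ny.
Qed.

(** The last step of [y] enters [A'], so a repetition in [y] must already occur in [x]. *)
Lemma cut_lift n (y : 'I_n.+2 -> X') (x : 'I_n.+1 -> X) :
  (forall k, out_of i (x k)) -> y \o @ordl n.+1 = g \o x ->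
  ~ out_of j (y ord_max) -> cut n (tuple_chain R y) = tuple_chain R x.
Proof.
move=> nx yx ny; have [ry|nry] := pselect (regular y).
  by rewrite cut_reg //; case: asboolP => // _; rewrite yx pull_lift.
rewrite !tuple_chain_irr ?linear0 // => rx.
apply: nry => k; have [[l ->]|->] := ord_ordlP k.
  rewrite (_ : ordr (ordl l) = ordl (ordr l)); last exact: val_inj.
  move/funeqP: yx => yx; have := yx (ordl l); have := yx (ordr l) => /= -> ->.
  by move=> /g_inj; move=> /(_ (nx _) (nx _))/rx.
rewrite (_ : ordr ord_max = ord_max); last exact: val_inj.
move=> E; apply: ny; rewrite -E; move/funeqP: yx => /(_ ord_max) /= ->.
exact: g_out.
Qed.

(** No edge leaves [A'], so the vertices outside [A'] form an initial segment: all of [y], all but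
    the last, or at most all but two. *)
Lemma cross_cases n (y : 'I_n.+2 -> X') : is_path y ->
  [\/ exists2 x, forall k, out_of i (x k) & g \o x = y,
      (exists2 x, forall k, out_of i (x k) & g \o x = y \o @ordl n.+1) /\
        ~ out_of j (y ord_max)
    | ~ out_of j (y (ordl ord_max)) /\ ~ out_of j (y ord_max)].
Proof.
move=> py; have [n1|n1] := pselect (out_of j (y ord_max)).
  apply: Or31; apply: lift_out => k.
  by apply: (out_path sink_j py _ n1); exact: leq_ord.
have [n0|n0] := pselect (out_of j (y (ordl ord_max))); last exact: Or33.
apply: Or32; split=> //; apply: lift_out => k.
by apply: (out_path sink_j py _ n0); exact: leq_ord.
Qed.

(** [pull] fails to be a chain map only on paths with just the last vertex in [A']: their last face
    lies outside [A'] and gives the extra [cut] term. *)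
Lemma pull_diff n (y : 'I_n.+2 -> X') : is_path y ->
  pull n (chain_diff R X' n (tuple_chain R y)) =
  chain_diff R X n (pull n.+1 (tuple_chain R y)) +
  (-1) ^+ n.+1 *: cut n (tuple_chain R y).
Proof.
move=> py; rewrite chain_diff_tuple /tuple_diff (linear_sum (pull n)).
case: (cross_cases py) => [[x nx yE]|[[x nx yE] n1]|[n0 n1]].
- rewrite -yE pull_lift // cut_out ?scaler0 ?addr0; last exact: g_out.
  rewrite chain_diff_tuple; apply: eq_bigr => k _.
  rewrite linearZ_LR /=; congr (_ *: _).
  by apply: (@pull_lift _ (face k x)) => l; exact: nx.
- rewrite (pull_cross n1) linear0 add0r (cut_lift nx _ n1) //.
  rewrite big_ord_recr /= big1 ?add0r => [|k _].
    by rewrite linearZ_LR /= face_max -yE pull_lift.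
  rewrite linearZ_LR /= (@pull_cross _ _ ord_max) ?scaler0 //.
  by rewrite (face_ordl_max y k).
- rewrite (pull_cross n1) linear0 add0r (cut_cross n0) scaler0 big1 // => k _.
  rewrite linearZ_LR /= (@pull_cross _ _ ord_max) ?scaler0 //.
  have [[l ->]|->] := ord_ordlP k; first by rewrite (face_ordl_max y l).
  by rewrite face_max.
Qed.

(** Deleting a vertex outside [A'] commutes with cutting. The other faces contribute only if exactly
    two vertices lie in [A'], and then they cancel. *)
Lemma cut_diff n (y : 'I_n.+3 -> X') : is_path y ->
  cut n (chain_diff R X' n.+1 (tuple_chain R y)) =
  chain_diff R X n (cut n.+1 (tuple_chain R y)).
Proof.
move=> py; rewrite chain_diff_tuple /tuple_diff (linear_sum (cut n)).
case: (cross_cases py) => [[x nx yE]|[[x nx yE] n1]|[n0 n1]].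
- rewrite -yE cut_out ?linear0; last exact: g_out.
  rewrite big1 // => k _; rewrite linearZ_LR /= cut_out ?scaler0 //.
  exact: g_out.
- rewrite (cut_lift nx _ n1) // chain_diff_tuple big_ord_recr /=.
  rewrite linearZ_LR /= cut_out ?scaler0 ?addr0; last first.
    by rewrite face_max -yE; exact: g_out.
  apply: eq_bigr => k _; rewrite linearZ_LR /=; congr (_ *: _).
  apply: cut_lift => [l||]; first exact: nx.
    by apply: (etrans (face_ordl y k)); rewrite -yE.
  by rewrite [X in ~ out_of j X](face_ordl_max y k).
rewrite (cut_cross n0) linear0.
have [n2|n2] := pselect (out_of j (y (ordl (ordl ord_max)))); last first.
  (* At least three vertices lie in [A'], so every face keeps two. *)
  rewrite big1 // => k _.
  rewrite linearZ_LR /= (@cut_cross _ _ ord_max) ?scaler0 //.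
  rewrite /face; have [[l ->]|->] := ord_ordlP k.
    have [[l' ->]|->] := ord_ordlP l.
      rewrite (_ : lift _ _ = ordl ord_max) //; apply: val_inj.
      by rewrite /= /bump; have /= := ltn_ord l'; lia.
    rewrite (_ : lift _ _ = ordl (ordl ord_max)) //; apply: val_inj.
    by rewrite /= /bump; lia.
  rewrite (_ : lift _ _ = ordl (ordl ord_max)) //; apply: val_inj.
  by rewrite /= /bump; lia.
have [x nx yE] : exists2 x, forall k, out_of i (x k) &
    g \o x = y \o @ordl n.+2 \o @ordl n.+1.
  apply: lift_out => k; apply: (out_path sink_j py _ n2).
  exact: leq_ord.
(* Deleting either of the two vertices in [A'] leaves the same cut, with opposite signs. *)
rewrite 2!big_ord_recr /= big1 ?add0r => [|k _].
  rewrite !linearZ_LR /= !(@cut_lift _ _ x) //.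
  - by rewrite [(-1) ^+ n.+2]exprS mulN1r scaleNr addrN.
  - by rewrite face_max.
  - by rewrite face_max.
  - by apply: (etrans (face_ordl y ord_max)); rewrite face_max.
  - by rewrite (face_ordl_max y ord_max).
rewrite linearZ_LR /= (@cut_cross _ _ ord_max) ?scaler0 //.
rewrite /face (_ : lift _ _ = ordl ord_max) //; apply: val_inj.
by rewrite /= /bump; have /= := ltn_ord k; lia.
Qed.

Lemma in_image_of (y : X') : ~ out_of j y -> exists a', y = j a'.
Proof. exact: contrapT. Qed.

Lemma pull_allowed n c : allowed R X' n c -> allowed R X n (pull n c).
Proof.
move=> ac; apply: chain_supp_ind => y ry cy; have py := allowed_supp ac cy.
have [ny|/existsNP[k nk]] := pselect (forall k, out_of j (y k)); last first.
  by rewrite (pull_cross nk); exact: submod0.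
have [x nx yE] := lift_out ny; rewrite -yE pull_lift //; apply: allowed_tuple.
by move=> k; apply: g_edge => //; move: (py k); rewrite -yE.
Qed.

Lemma cross_edge n (y : 'I_n.+2 -> X') (x : 'I_n.+1 -> X) : is_path y ->
  (forall k, out_of i (x k)) -> g \o x = y \o @ordl n.+1 ->
  ~ out_of j (y ord_max) ->
  exists2 a, edge (x ord_max) (i a) & y ord_max = j (f a).
Proof.
move=> py nx /funeqP yE /in_image_of[a' yE'].
have := py ord_max; rewrite -[y (ordl _)](yE ord_max) /=.
rewrite (_ : ordr ord_max = ord_max) ?yE'; last exact: val_inj.
by move=> /g_edge_in[//|a xa <-]; exists a.
Qed.

Lemma cut_ending n c : allowed R X' n.+1 c -> ending R i n (cut n c).
Proof.
move=> ac; apply: chain_supp_ind => y ry cy; have py := allowed_supp ac cy.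
case: (cross_cases py) => [[x nx yE]|[[x nx yE] n1]|[n0 n1]].
- by rewrite cut_out ?linear0 -?yE; [exact: submod0|exact: g_out].
- rewrite (cut_lift nx) // => W; apply; exists x => //; split=> //.
    move=> k; apply: g_edge => //; move/funeqP: yE => yE.
    rewrite [g _](yE (ordl k)) [g _](yE (ordr k)) /=.
    by have := py (ordl k); congr (edge _ (y _)); exact: val_inj.
  by have [a xa _] := cross_edge py nx yE n1; exists a.
- by rewrite (cut_cross n0); exact: submod0.
Qed.

(** The sign makes the [cut] term of [pull_diff] cancel the term [- cut m w] in the boundary of the
    prism. *)
Definition excise m (w : path_chain R X' m.+1) : path_chain R X m.+1 :=
  pull m.+1 w + (-1) ^+ m *: prism R p m (cut m w).

(** In the prism formula the image under [p] is allowed because [cut m w] is ending. For positive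
    [m], the boundary of [cut m w] is a cut of the allowed boundary of [w], so its prism is allowed
    as well. *)
Lemma diff_prism_cut m w : omega R X' m.+1 w ->
  exists2 e, allowed R X m e &
    chain_diff R X m (prism R p m (cut m w)) = e - cut m w.
Proof.
move=> [aw adw]; have pe := push_ending p_edge p_step (cut_ending aw).
case: m => [|m] in w aw adw pe *.
  by exists (push R p 0 (cut 0 w)); rewrite // diff_prism0.
exists (push R p m.+1 (cut m.+1 w) -
        prism R p m (cut m (chain_diff R X' m.+1 w))).
  apply: submodB => //.
  exact: prism_ending p_edge p_step _ _ (cut_ending adw).
rewrite diff_prism addrAC; congr (_ - prism R p m _ - _).
apply: (@eq_on_supp _ _ _ _ (chain_diff R X m \o cut m.+1)
  (cut m \o chain_diff R X' m.+1)) => y ry wy /=.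
by rewrite cut_diff //; exact: allowed_supp wy.
Qed.

Lemma excise_omega m w : omega R X' m.+1 w -> omega R X m.+1 (excise w).
Proof.
move=> Ow; have [aw adw] := Ow; split.
  apply: submodD; first exact: pull_allowed.
  by apply: submodZ; exact: prism_ending p_edge p_step _ _ (cut_ending aw).
have [e ae dE] := diff_prism_cut Ow.
have pE : pull m (chain_diff R X' m w) =
    chain_diff R X m (pull m.+1 w) + (-1) ^+ m.+1 *: cut m w.
  apply: (@eq_on_supp _ _ _ _ (pull m \o chain_diff R X' m)
    ((chain_diff R X m \o pull m.+1) \+ ((-1) ^+ m.+1 \*: cut m))) => y ry wy /=.
  by rewrite pull_diff //; exact: allowed_supp wy.
suff -> : chain_diff R X m (excise w) =
    pull m (chain_diff R X' m w) + (-1) ^+ m *: e.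
  by apply: submodD; [exact: pull_allowed|exact: submodZ].
rewrite pE /excise linearD linearZ_LR /= dE scalerBr exprS mulN1r scaleNr.
by rewrite -addrA; congr (_ + _); rewrite addrC.
Qed.

(** Only paths with at most the last vertex in [A'] are compared, and on these lifting and mapping
    back changes nothing. *)
Lemma excise_coef m (y z : 'I_m.+2 -> X') : is_path z ->
  out_of j (y (ordl ord_max)) ->
  tcoef y (path_map R g m.+1 (excise (tuple_chain R z))) =
  tcoef y (tuple_chain R z).
Proof.
move=> pz ny; rewrite /excise.
case: (cross_cases pz) => [[x nx zE]|[[x nx zE] n1]|[n0 n1]].
- rewrite -zE pull_lift // cut_out; last exact: g_out.
  by rewrite linear0 scaler0 addr0 path_map_tuple.
- rewrite (pull_cross n1) (cut_lift nx) // add0r prism_tupleE /prism_chain.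
  have [a xa zE'] := cross_edge pz nx zE n1.
  (* The summand [k = m] applies [p] only in its last entry, which is [i a] by [p_edge]; its image
     is [z], and the two signs cancel. *)
  rewrite big_ord_recr scalerDr 2!linearD /= [X in X + _](_ : _ = 0) ?add0r.
    rewrite scalerA -expr2 sqrr_sign scale1r path_map_tuple.
    congr (tcoef _ (tuple_chain R _)); apply/funext => k /=.
    rewrite /prism_tuple; have [[l ->]|->] := ord_ordlP k.
      rewrite /= leq_ord (_ : inord _ = l); last exact: inord_val.
      by move/funeqP: zE => /(_ l).
    rewrite ltnn (_ : inord _ = ord_max).
      by rewrite (p_edge (nx _) xa) comm zE'.
    by apply: val_inj; rewrite /= inordK.
  (* The earlier summands have a value of [p] before the last entry, hence a vertex of [A'] there,
     unlike [y]. *)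
  rewrite scaler_sumr (linear_sum (path_map R g m.+1)) (linear_sum (tcoef y)).
  rewrite big1 // => k _; rewrite !linearZ_LR /= path_map_tuple.
  rewrite tcoef_tuple_neq ?scaler0 // => /funeqP/(_ (ordl ord_max)) /=.
  rewrite /prism_tuple /= leqNgt ltn_ord /=.
  have [b ->] := p_in a (x (inord m.-1)); rewrite comm => E.
  by apply: ny; exists (f b).
- rewrite (pull_cross n1) (cut_cross n0) linear0 scaler0 addr0 !linear0.
  by rewrite tcoef_tuple_neq // => zy; apply: n0; rewrite zy.
Qed.

(** Surjectivity on relative chains: [omega_rel0] for [j] reduces it to the coefficients treated in
    [excise_coef]. *)
Lemma omega_lift n (w : path_chain R X' n) : omega R X' n w ->
  exists v, omega R X n v /\
    exists u, omega R A' n u /\ path_map R j n u = path_map R g n v - w.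
Proof.
case: n w => [|m] w Ow; have aw := omega_allowed Ow.
  (* In degree 0 there is nothing to cut: the vertices outside [A'] lift directly. *)
  exists (pull 0 w); have Ov : omega R X 0 (pull 0 w) by exact: pull_allowed.
  split=> //; apply: (omega_rel0 sink_j).
    by apply: submodB => //; exact: path_map_omega.
  move=> y ry py ny; rewrite linearB /=; apply/eqP; rewrite subr_eq0; apply/eqP.
  apply: (@eq_on_supp _ _ _ _ (tcoef y \o (path_map R g 0 \o pull 0))
    (tcoef y)) => z rz wz /=.
  have [nz|nz] := pselect (forall k, out_of j (z k)).
    by have [x nx <-] := lift_out nz; rewrite pull_lift // path_map_tuple.
  rewrite [RHS]tcoef_tuple_neq => [|zy]; last first.
    by apply: nz => k; rewrite zy (ord1 k); exact: ny.
  by move/existsNP: nz => [k nk]; rewrite (pull_cross nk) !linear0.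
exists (excise w); have Ov := excise_omega Ow; split=> //.
apply: (omega_rel0 sink_j).
  by apply: submodB => //; exact: path_map_omega.
move=> y ry py ny; rewrite linearB /=; apply/eqP; rewrite subr_eq0; apply/eqP.
apply: (@eq_on_supp _ _ _ _ (tcoef y \o (path_map R g m.+1 \o
  (pull m.+1 \+ ((-1) ^+ m \*: (prism R p m \o cut m))))) 
  (tcoef y)) => z rz wz /=.
apply: excise_coef; first exact: allowed_supp wz.
exact: ny.
Qed.

(** Injectivity on relative chains: a path [x] with at most the last vertex in [A] is the only path
    over [g \o x], so its coefficient survives in the image, where chains from [A'] have none. *)
Lemma omega_reflect n (v : path_chain R X n) (u : path_chain R A' n) :
  omega R X n v -> path_map R g n v = path_map R j n u ->
  exists u', omega R A n u' /\ path_map R i n u' = v.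
Proof.
case: (sink_i) => _ noout one_edge Ov E; have av := omega_allowed Ov.
apply: (omega_rel0 sink_i) => // x rx px Hx.
have g_in x0 : ~ out_of i x0 -> ~ out_of j (g x0).
  by move=> /contrapT[a ->]; apply; exists (f a); exact: comm.
(* The last index at which [x] is known to be outside [A]; it is 0 when [n = 0]. *)
pose t : 'I_n.+1 := inord n.-1.
have tE : t = n.-1 :> nat by rewrite inordK //; lia.
have nt : out_of i (x t) by exact: Hx.
have nx (k : 'I_n.+1) : (k <= t)%N -> out_of i (x k).
  by move=> kt; exact: (out_path sink_i px kt nt).
have [rgx|nrgx] := pselect (regular (g \o x)); last first.
  case: nrgx => k /= gk; apply: (rx k).
  have nk : out_of i (x (ordl k)).
    by apply: nx; rewrite tE /=; have := ltn_ord k; lia.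
  apply: g_inj => //; apply: contrapT => /g_in; apply; rewrite -gk.
  exact: g_out.
have <- : tcoef (g \o x) (path_map R g n v) = tcoef x v.
  apply: (@eq_on_supp _ _ _ _ (tcoef (g \o x) \o path_map R g n)
    (tcoef x)) => z rz vz /=.
  have pz := allowed_supp av vz.
  suff gzxE : (g \o z = g \o x) <-> (z = x).
    by rewrite path_map_tuple !tcoef_tuple // (asbool_equiv_eq gzxE).
  split=> [/funeqP gzx|->//]; apply/funext => k.
  have eq_out l : out_of i (x l) -> z l = x l.
    move=> nl; apply: g_inj => //; last exact: gzx.
    apply: contrapT => /g_in; apply.
    by rewrite [g _]gzx; exact: g_out.
  have [/eq_out//|nk] := pselect (out_of i (x k)).
  (* Now [k] is the last index, and the vertices of [x] and [z] there are both the unique target in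
     [A] of an edge from [x t]. *)
  have kt : (t < k)%N by rewrite ltnNge; apply/negP => /nx.
  have kn := ltn_ord k.
  have tn : (t < n)%N by lia.
  have tl : ordl (Ordinal tn) = t by apply: val_inj.
  have tr : ordr (Ordinal tn) = k by apply: val_inj; rewrite /= /bump; lia.
  have [b xb] : exists b, x k = i b by exact: contrapT nk.
  have [c zc] : exists c, z k = i c.
    apply: contrapT => /g_out; rewrite [g _]gzx /=; exact: g_in.
  rewrite xb zc; congr (i _); apply: (one_edge _ _ _ nt).
    by rewrite -zc -(eq_out _ nt) -tl -tr.
  by rewrite -xb -tl -tr.
(* A tuple from [A'] cannot equal [g \o x], whose entry at [t] is outside [A']. *)
rewrite E; apply: (@eq_on_supp _ _ _ _ (tcoef (g \o x) \o path_map R j n) \0).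
move=> z rz uz /=; rewrite path_map_tuple tcoef_tuple_neq // => /funeqP jg.
by apply: (g_out nt); exists (z t); exact: esym (jg t).
Qed.

End Excision.

(** * Homology of degreewise bijective chain maps *)

Lemma homology_map_bijective (R : pzRingType) (C D : complex R)
    (F : chain_map C D) n :
  (forall m, injective (F m)) -> (forall m y, exists x, F m x = y) ->
  bijective (homology_map F n).
Proof.
move=> Finj Fsurj; apply: inj_surj_bijective => [q q'|q].
  rewrite -[q]quot_reprK -[q']quot_reprK.
  move: (quot_repr q) (quot_repr q') => z z'.
  rewrite /homology_map /= !quot_mapE => /quot_eqP[y /= dy]; apply/quot_eqP => /=.
  have [x xE] := Fsurj _ y; exists x; apply: (Finj n).
  by rewrite cmap_diff xE dy /= linearB.
rewrite -[q]quot_reprK; move: (quot_repr q) => z.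
have [x xE] := Fsurj _ (val z).
have cx : cycles C n x.
  have := submod_typeP z; rewrite -xE.
  case: n q z x xE => //= m _ z x _ dx; apply: (Finj m).
  by rewrite cmap_diff dx linear0.
exists (quot_pi _ (submod_in cx)); rewrite /homology_map /= quot_mapE.
by congr quot_pi; apply: val_inj => /=.
Qed.

(** * The projection of a cofibration on short paths *)

Section CofibrationRetraction.
Variables (A X : digraph) (i : dimap A X).

Lemma path_length1 x y : edge x y ->
  exists q : 'I_2 -> X, path_from_to x y q.
Proof.
move=> xy; exists (tcons x (fun=> y)); split; rewrite ?tcons0 //.
  by apply/is_path_tcons; split=> // -[].
by rewrite (_ : ord_max = lift ord0 ord0) ?tconsS //; apply: val_inj.
Qed.

Lemma path_length2 x y z : edge x y -> edge y z ->
  exists q : 'I_3 -> X, path_from_to x z q.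
Proof.
move=> xy /path_length1[q [pq q0 q1]]; exists (tcons x q); split.
- by apply/is_path_tcons; rewrite q0.
- exact: tcons0.
- by rewrite (_ : ord_max = lift ord0 ord_max) ?tconsS //; apply: val_inj.
Qed.

(** Only paths of length one and two into [A] matter: a minimal path is no longer, so few positions
    on it are left for the projection of [x]. *)
Lemma cofibration_retraction : cofibration i ->
  exists p : X -> X,
    [/\ forall x a, out_of i x -> edge x (i a) -> p x = i a,
        forall x y a, out_of i x -> out_of i y -> edge x y ->
          edge y (i a) ->
          p x = p y \/ exists2 b, edge x (i b) & edge (i b) (p y)
      & A -> forall x, exists b, p x = i b].
Proof.
move=> [_ _ [pi piP]].
(* Vertices without a path into [A] get an arbitrary value in [A], or stay fixed if [A] is empty. *)
pose r x := match pselect (exists a, has_path x (i a)) with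
            | left h => i (pi (exist _ x h))
            | right _ => if pselect (exists a : A, True) is left h
                         then i (projT1 (cid h)) else x
            end.
have r_path x a m (q : 'I_m.+1 -> X) : path_from_to x (i a) q ->
  exists n (q' : 'I_n.+1 -> X),
    [/\ (n <= m)%N, path_from_to x (i a) q' & exists k, q' k = r x].
  move=> qP; have xa : has_path x (i a) by exists m, q.
  rewrite /r; case: pselect => [h|[]]; last by exists a.
  have [n [q' [[q'P minq] q'k]]] := piP (exist _ x h) a xa.
  by exists n, q'; split=> //; exact: minq qP.
have r_in x a : has_path x (i a) -> exists b, r x = i b.
  move=> xa; rewrite /r; case: pselect => [h|[]]; last by exists a.
  by exists (pi (exist _ x h)).
have r_edge x a : out_of i x -> edge x (i a) -> r x = i a.
  move=> nx /path_length1[q qP].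
  have [b rb] : exists b, r x = i b by apply: (r_in _ a); exists 1%N, q.
  have [n [q' [n1 [_ q'0 q'm] [k q'k]]]] := r_path _ _ _ _ qP.
  (* On a path of length at most one, [r x] is an end point, and not the start, which is outside
     [A]. *)
  case: n => [|[|//]] in q' n1 q'0 q'm k q'k *.
    by case: nx; exists b; rewrite -rb -q'k -q'0 (ord1 k).
  have [[l kl]|kmax] := ord_ordlP k; last by rewrite -q'k kmax.
  case: nx; exists b; rewrite -rb -q'k -q'0 kl (ord1 l).
  by congr q'; apply: val_inj.
exists r; split=> // [x y a nx ny xy ya|a x]; last first.
  rewrite /r; case: pselect => [h|_]; first by eexists.
  by case: pselect => [h|[]]; [eexists|exists a].
rewrite (r_edge y a) //; have [q qP] := path_length2 xy ya.
have [b rb] : exists b, r x = i b by apply: (r_in _ a); exists 2, q.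
have [n [q' [n2 [pq' q'0 q'm] [k q'k]]]] := r_path _ _ _ _ qP.
(* The position of [r x] is not the start; at the end, [r x] equals [r y]; strictly between, the
   path has length two and [r x] is its middle vertex. *)
have [k0|kn0] := eqVneq k ord0.
  by case: nx; exists b; rewrite -rb -q'k -q'0 k0.
have [kE|knm] := eqVneq k ord_max; first by left; rewrite -q'k kE.
right; have {}kn0 : k <> 0 :> nat by move=> E; case/eqP: kn0; apply: val_inj.
have {}knm : k <> n :> nat by move=> E; case/eqP: knm; apply: val_inj.
have kn := ltn_ord k; have n2E : n = 2 by lia.
subst n.
have k1 : k = 1 :> nat by lia.
exists b; rewrite -rb -q'k -?q'0 -?q'm.
  by have := pq' ord0; congr (edge (q' _) (q' _)); apply: val_inj;
  rewrite /= ?/bump; lia.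
by have := pq' ord_max; congr (edge (q' _) (q' _)); apply: val_inj;
  rewrite /= ?/bump; lia.
Qed.

End CofibrationRetraction.

(** * Explicit form of the pushout *)

Section PushoutStructure.
Variables (A X A' X' : digraph).
Variables (i : dimap A X) (f : dimap A A') (g : dimap X X') (j : dimap A' X').
Hypothesis cof_i : cofibration i.
Hypothesis po : is_pushout i f g j.

(** Two edges from [x] into [A] both end at [p x]. *)
Lemma cofibration_sink : sink_inclusion i.
Proof.
have [ind_i noout _] := cof_i.
have [p [p_edge _ _]] := cofibration_retraction cof_i.
split=> // x a b nx xa xb; apply: ind_i.1.
by rewrite -(p_edge x a) // (p_edge x b).
Qed.

(** An explicit model of the pushout: the part of [X] outside [A] attached to [A']. *)
Definition glue_edge (u v : A' + {x : X | out_of i x}) : Prop :=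
  match u, v with
  | inl a', inl b' => edge a' b'
  | inl _, inr _ => False
  | inr x, inl a' => exists2 a, edge (sval x) (i a) & f a = a'
  | inr x, inr y => edge (sval x) (sval y)
  end.

Lemma glue_edge_refl u : glue_edge u u.
Proof. by case: u => u; exact: edge_refl. Qed.

Definition glue : digraph := Digraph glue_edge_refl.

Definition glue_left_fun (x : X) : glue :=
  match pselect (exists a, x = i a) with
  | left h => inl (f (projT1 (cid h)))
  | right nx => inr (exist _ x nx)
  end.

Lemma glue_left_in a : glue_left_fun (i a) = inl (f a).
Proof.
have [[i_inj _] _ _] := cofibration_sink.
rewrite /glue_left_fun; case: pselect => [h|[]]; last by exists a.
by case: cid => b /= /i_inj ->.
Qed.

Lemma glue_left_out x (nx : out_of i x) : glue_left_fun x = inr (exist _ x nx).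
Proof.
rewrite /glue_left_fun; case: pselect => // nx'.
by rewrite (Prop_irrelevance nx' nx).
Qed.

Lemma glue_left_edge x y :
  edge x y -> edge (glue_left_fun x) (glue_left_fun y).
Proof.
have [[i_inj i_ind] noout _] := cofibration_sink.
have [[a ->]|nx] := pselect (exists a, x = i a).
  move=> xy; have [b yb] := noout _ _ xy; move: xy; rewrite yb !glue_left_in.
  by move=> /i_ind; exact: dimap_edge.
have [[b ->]|ny] := pselect (exists a, y = i a) => xy.
  by rewrite (glue_left_out nx) glue_left_in; exists b.
by rewrite (glue_left_out nx) (glue_left_out ny).
Qed.

Definition glue_left : dimap X glue := DiMap glue_left_edge.

Definition glue_right : dimap A' glue :=
  @DiMap A' glue inl (fun a b ab => ab).

Definition unglue_fun (u : glue) : X' :=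
  match u with inl a' => j a' | inr x => g (sval x) end.

Lemma unglue_edge u v : edge u v -> edge (unglue_fun u) (unglue_fun v).
Proof.
case: u v => [a'|x] [b'|y] //=; try exact: dimap_edge.
by move=> [a xa <-]; rewrite -(pushout_comm po); exact: dimap_edge.
Qed.

(** The universal property gives [w], and its uniqueness clause shows that [unglue_fun] undoes [w].
    Vertices and edges of [X'] are then read off in [glue]. *)
Lemma pushout_glue : exists w : dimap X' glue,
  [/\ forall x, w (g x) = glue_left x, forall a', w (j a') = inl a'
    & forall y, y = unglue_fun (w y)].
Proof.
have [w [wg wj]] := pushout_exists po (u := glue_left) (v := glue_right)
  glue_left_in.
exists w; split=> // y.
pose idX' : dimap X' X' := @DiMap X' X' id (fun _ _ h => h).
pose r : dimap X' X' := @DiMap X' X' (fun y => unglue_fun (w y))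
  (fun _ _ h => unglue_edge (dimap_edge w h)).
apply: (pushout_unique po (w := idX') (w' := r)) => [x|a'] /=; last by rewrite wj.
rewrite wg /=; have [[a ->]|nx] := pselect (exists a, x = i a).
  by rewrite glue_left_in /= (pushout_comm po).
by rewrite (glue_left_out nx).
Qed.

Lemma pushout_sink : sink_inclusion j.
Proof.
have [w [wg wj wK]] := pushout_glue.
have [_ _ one_edge] := cofibration_sink.
split; first split.
- by move=> a b /(congr1 w); rewrite !wj => -[].
- by move=> a b /(dimap_edge w); rewrite !wj.
- move=> a x /(dimap_edge w); rewrite wj [x in exists _, x = _]wK.
  by case: (w x) => //= b _; exists b.
- move=> y a b ny /(dimap_edge w) + /(dimap_edge w); rewrite !wj.
  have := wK y; case: (w y) => [c yE|[x nx] _ /= [a1 xa1 <-] [a2 xa2 <-]].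
    by case: ny; exists c.
  by rewrite (one_edge x a1 a2).
Qed.

Lemma pushout_out x : out_of i x -> out_of j (g x).
Proof.
have [w [wg wj wK]] := pushout_glue.
by move=> nx [a /(congr1 w)]; rewrite wg wj /= (glue_left_out nx).
Qed.

Lemma pushout_inj x y : out_of i x -> out_of i y -> g x = g y -> x = y.
Proof.
have [w [wg wj wK]] := pushout_glue.
move=> nx ny /(congr1 w); rewrite !wg /= (glue_left_out nx) (glue_left_out ny).
by move=> -[].
Qed.

Lemma pushout_surj y : out_of j y -> exists2 x, out_of i x & g x = y.
Proof.
have [w [wg wj wK]] := pushout_glue.
move=> ny; have := wK y; case: (w y) => [c yE|[x nx] /= ->].
  by case: ny; exists c.
by exists x.
Qed.

Lemma pushout_edge x y :
  out_of i x -> out_of i y -> edge (g x) (g y) -> edge x y.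
Proof.
have [w [wg wj wK]] := pushout_glue.
move=> nx ny /(dimap_edge w).
by rewrite !wg /= (glue_left_out nx) (glue_left_out ny).
Qed.

Lemma pushout_edge_in x a' :
  out_of i x -> edge (g x) (j a') -> exists2 a, edge x (i a) & f a = a'.
Proof.
have [w [wg wj wK]] := pushout_glue.
by move=> nx /(dimap_edge w); rewrite wg wj /= (glue_left_out nx).
Qed.

End PushoutStructure.

Theorem theorem3p5 (R : comPzRingType) (A X A' X' : digraph)
  (i : dimap A X) (f : dimap A A') (g : dimap X X') (j : dimap A' X')
  (cof_i : cofibration i) (po : is_pushout i f g j) (n : nat) :
  bijective (rel_homology_map R (pushout_comm po) n).
Proof.
have [p [p_edge p_step p_in]] := cofibration_retraction cof_i.
have sink_i := cofibration_sink cof_i.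
have sink_j := pushout_sink cof_i po.
have g_out := pushout_out cof_i po.
have g_inj := pushout_inj cof_i po.
have g_surj := pushout_surj cof_i po.
have g_edge := pushout_edge cof_i po.
have g_edge_in := pushout_edge_in cof_i po.
apply: homology_map_bijective => m.
  (* Trivial kernel: a relative chain with zero image is represented by a chain whose image comes
     from Omega(A'). *)
  apply: raddf_inj => q; rewrite -[q]quot_reprK; move: (quot_repr q) => v.
  rewrite /rel_chain_map /= /quot_cmap /= quot_mapE.
  rewrite -[0 in X in X -> _](linear0 (quot_pi _)) => /quot_eqP[u /=].
  rewrite subr0 => uE; rewrite -(linear0 (quot_pi _)); apply/quot_eqP; rewrite subr0.
  have [u' [Ou' u'E]] := omega_reflect (u := val u) (pushout_comm po) sink_i g_out
    g_inj (submod_typeP v) (esym (congr1 val uE)).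
  by exists (submod_in Ou'); apply: val_inj.
move=> q; rewrite -[q]quot_reprK; move: (quot_repr q) => w.
have [v [Ov [u [Ou uE]]]] := omega_lift (pushout_comm po) sink_j
  p_edge p_step p_in g_out g_inj g_surj g_edge g_edge_in (submod_typeP w).
exists (quot_pi _ (submod_in Ov)).
rewrite /rel_chain_map /= /quot_cmap /= quot_mapE; apply/quot_eqP.
by exists (submod_in Ou); apply: val_inj.
Qed.
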